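(* Let $\mu$ be a non-negative Borel measure on $[0,\infty)$, put $M(t)=\int_{[0,t]}\mu(ds)$ for $t\ge 0$, and suppose $M(t)<\infty$ for all $t\ge 0$, $\lim_{t\to\infty}M(t)=\infty$ and $M\in \mathrm{RV}_\infty(\theta)$ for some $\theta\ge 0$. Let $f\in \mathrm{RV}_\infty(\beta)$ with $\beta\in[0,1)$; when $\beta=0$ suppose in addition that $f$ is asymptotically increasing and $\lim_{x\to\infty}f(x)=\infty$. Let $\xi>0$ and let $x$ be the continuous solution $x:[0,\infty)\to(0,\infty)$ of $$x'(t)=\int_{[0,t]}\mu(ds)\,f(x(t-s)),\quad t>0;\qquad x(0)=\xi.$$ Then $x\in \mathrm{RV}_\infty\left(\frac{1+\theta}{1-\beta}\right)$ and $$\lim_{t\to\infty}\frac{F(x(t))}{\bar M(t)}=\frac{\Gamma(\theta+1)\,\Gamma\left(\frac{1+\beta\theta}{1-\beta}\right)}{\Gamma\left(\frac{1+\theta}{1-\beta}\right)},$$ where $F(x)=\int_1^x\frac{du}{f(u)}$ for $x>0$, $\bar M(t)=\int_0^t M(s)\,ds$, and $\Gamma(x)=\int_0^\infty t^{x-1}e^{-t}\,dt$.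
   Context: $\mathrm{RV}_\infty(\rho)$ ($\rho\in\mathbb{R}$) denotes the class of measurable functions $h$, positive for all sufficiently large arguments, with $\lim_{x\to\infty}h(\lambda x)/h(x)=\lambda^\rho$ for every $\lambda>0$. The function $f:[0,\infty)\to[0,\infty)$ is continuous and positive on $(0,\infty)$. Write $a(x)\sim b(x)$ if $a(x)/b(x)\to1$ as $x\to\infty$. ''$f$ asymptotically increasing'' means there is $\phi\in C^1((0,\infty);(0,\infty))\cap C([0,\infty);(0,\infty))$ with $\phi'(x)>0$ for all $x>0$ and $f(x)\sim\phi(x)$ as $x\to\infty$. The differential equation is understood in its equivalent integral form $x(t)=\xi+\int_0^t M(t-s)f(x(s))\,ds$, $t\ge 0$. Existence and uniqueness of the continuous positive solution on $[0,\infty)$ is part of the standing framework and is taken as given. *)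

(* Defs.v *)
From HB Require Import structures.
From mathcomp Require Import all_boot all_order all_algebra.
From mathcomp Require Import all_classical all_reals all_analysis.

Set Implicit Arguments.
Unset Strict Implicit.
Unset Printing Implicit Defensive.

Import Order.TTheory GRing.Theory Num.Theory.
Import numFieldNormedType.Exports.

Local Open Scope classical_set_scope.
Local Open Scope ring_scope.

(* Functions on [0, +oo[ are represented by functions R -> R, whose values on
   negative arguments are irrelevant. *)

(* The class RV_oo(rho). *)
Definition regularly_varying (R : realType) (rho : R) (h : R -> R) : Prop :=
  [/\ measurable_fun (`[0, +oo[ : set R) h,
      \forall x \near +oo, 0 < h x &
      forall lambda : R, 0 < lambda ->
        h (lambda * x) / h x @[x --> +oo] --> lambda `^ rho].

Definition asymp_equiv (R : realType) (a b : R -> R) : Prop :=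
  a x / b x @[x --> +oo] --> (1 : R).

Definition asymp_increasing (R : realType) (f : R -> R) : Prop :=
  exists phi : R -> R,
    [/\ {within `[0, +oo[, continuous phi} /\ (forall x, 0 <= x -> 0 < phi x),
        (forall x, 0 < x -> derivable phi x 1) /\
          {in `]0, +oo[, continuous (derive1 phi)},
        (forall x, 0 < x -> 0 < derive1 phi x) &
        asymp_equiv f phi].

(* The measure on [0, +oo[ is represented by a measure on R, of which only the
   restriction to [0, +oo[ is ever used. *)
Definition cumul (R : realType) (mu : {measure set (measurableTypeR R) -> \bar R})
    (t : R) : R :=
  fine (mu `[0, t]%classic).

Definition is_solution (R : realType) (M f : R -> R) (xi : R) (x : R -> R) :
    Prop :=
  [/\ {within `[0, +oo[, continuous x},
      (forall t, 0 <= t -> 0 < x t) &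
      forall t, 0 <= t ->
        x t = xi + \int[lebesgue_measure]_(s in `[0, t]) (M (t - s) * f (x s))].

(* \int_a^b g, with the usual sign convention when b < a. *)
Definition oriented_integral (R : realType) (a b : R) (g : R -> R) : R :=
  if a <= b then \int[lebesgue_measure]_(u in `[a, b]) g u
  else - \int[lebesgue_measure]_(u in `[b, a]) g u.

(* Meaningful for 0 < x; for other x the integral may diverge. *)
Definition Gamma (R : realType) (x : R) : R :=
  \int[lebesgue_measure]_(t in `]0, +oo[) (t `^ (x - 1) * expR (- t)).

(* Main.v *)
(* Put [q t = x t / (t * M t * f (x t))]. The heart of the matter is that [q]
   tends to the Beta integral [J] of [(1 - l)^theta * l^(beta * gamma)] over
   [[0, 1]], with [gamma = (1 + theta) / (1 - beta)].

   Suppose [q] is not eventually above [v < J]. Then there are arbitrarily late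
   times [t] at which [q t] is at most (about) [v] and is almost minimal over the
   past. Writing [g u = u / f u], which is regularly varying of index
   [1 - beta > 0], almost minimality reads [g (x (l t)) >= l^(1 + theta) g (x t)]
   up to a factor close to [1], which forces
   [f (x (l t)) >= l^(beta * gamma) f (x t)]. Inserting this in the integral
   equation gives [q t >= J] up to a factor close to [1], a contradiction. The
   upper bound is obtained in the same way from almost maxima of [q].

   As [g (x t) ~ J t M t], the solution [x] is regularly varying of index
   [gamma], and Karamata's theorem, [F y ~ g y / (1 - beta)] and
   [Mbar t ~ t M t / (1 + theta)], turns the limit of [q] into that of
   [F (x t) / Mbar t], which is [gamma * J]. Tonelli's theorem expresses [J]
   through the Gamma function.

   The only uniformity needed is that [f] and [g] are almost increasing. For
   continuous regularly varying functions of positive index this follows from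
   Baire's theorem, and for [f] when [beta = 0] it is assumed. *)

Require Import Defs.
From HB Require Import structures.
From mathcomp Require Import all_boot all_order all_algebra.
From mathcomp Require Import all_classical all_reals all_analysis.
From mathcomp Require Import measurable_realfun ring lra.

Set Implicit Arguments.
Unset Strict Implicit.

Import Order.TTheory GRing.Theory Num.Theory.
Import numFieldNormedType.Exports.

Local Open Scope classical_set_scope.
Local Open Scope ring_scope.

(** * The Gamma and Beta integrals *)

Lemma powR_within_continuous (R : realType) (p : R) : 0 <= p ->
  {within `[0, +oo[, continuous (fun t : R => t `^ p)}.
Proof.
rewrite le_eqVlt => /predU1P[<-|p0].
  (* As $0^0 = 1$ for [powR], the exponent $0$ gives a constant function, continuous also at $0$. *)
  rewrite (_ : (fun t => _) = cst 1); last by apply/funext => t; exact: powRr0.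
  by move=> t; exact: cst_continuous.
apply/derivable_oy_Rcontinuous_within_itvcy; split => [t|].
  exact: derivable_powR.
by rewrite powR0 ?gt_eqF//; exact: powR_cvg0.
Qed.

Lemma powR_continuous (R : realType) (p x : R) : 0 < x ->
  {for x, continuous (fun t : R => t `^ p)}.
Proof.
move=> x0; apply: differentiable_continuous; apply/derivable1_diffP.
by apply: derivable_powR; rewrite in_itv/= x0.
Qed.

(* The arguments are shifted by one: [Gamma_ext p] is [Gamma (p + 1)], and
   [Beta_ext p q] is the Beta function at [(q + 1, p + 1)]. *)
Definition gamma_kernel (R : realType) (p t : R) : R := t `^ p * expR (- t).

Definition Gamma_ext (R : realType) (p : R) : \bar R :=
  \int[lebesgue_measure]_(t in `[0, +oo[) (gamma_kernel p t)%:E.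

Definition beta_kernel (R : realType) (p q t : R) : R := (1 - t) `^ p * t `^ q.

Definition Beta_ext (R : realType) (p q : R) : \bar R :=
  \int[lebesgue_measure]_(t in `[0, 1]) (beta_kernel p q t)%:E.

Section gamma.
Context {R : realType}.
Local Notation mu := (@lebesgue_measure R).
Implicit Types p q s u : R.

Lemma gamma_kernel_ge0 p t : 0 <= gamma_kernel p t.
Proof. by rewrite mulr_ge0 ?powR_ge0 ?expR_ge0. Qed.

Lemma measurable_gamma_kernel p (D : set R) :
  measurable D -> measurable_fun D (gamma_kernel p).
Proof.
move=> mD; apply: measurable_funTS; apply: measurable_funM.
  exact: measurable_powR.
by apply: measurableT_comp => //; exact: measurableT_comp.
Qed.

Lemma continuous_expRN : continuous (fun t : R => expR (- t)).
Proof.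
move=> t; apply: (@continuous_comp _ _ _ -%R (@expR R)).
  exact: oppr_continuous.
exact: continuous_expR.
Qed.

Lemma gamma_kernel_within_continuous p : 0 <= p ->
  {within `[0, +oo[, continuous (gamma_kernel p)}.
Proof.
move=> p0 t; apply: cvgM; first exact: powR_within_continuous.
exact: (continuous_subspaceT continuous_expRN).
Qed.

Lemma beta_kernel_within_continuous p q : 0 <= p -> 0 <= q ->
  {within `[0, 1], continuous (beta_kernel p q)}.
Proof.
move=> p0 q0.
have cq : {within `[0, 1], continuous (fun t : R => t `^ q)}.
  apply: (@continuous_subspaceW R^o _ _ [set` `[0, +oo[%R]).
    exact: subset_itvl.
  exact: powR_within_continuous.
have cp : {within `[0, 1], continuous (fun t : R => (1 - t) `^ p)}.
  move=> t.
  have /subspace_continuousP h := @powR_within_continuous R p p0.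
  move: t; apply/subspace_continuousP => t /= t01.
  have {}h := h (1 - t).
  rewrite /= in_itv/= andbT in h.
  have {}h : (x `^ p @[x --> within [set` `[0, +oo[%R] (nbhs (1 - t))] -->
    (1 - t) `^ p).
    apply: h; move: t01; rewrite /= in_itv/= => /andP[t0 t1].
    by rewrite subr_ge0.
  apply: (@cvg_comp _ _ _ (fun t => 1 - t) (fun t => t `^ p) _
    (within [set` `[0, +oo[%R] (nbhs (1 - t))) _ _ h).
  have c1 : continuous (fun x : R => 1 - x).
    by move=> x; apply: cvgB; [exact: cvg_cst|exact: cvg_id].
  move=> A hA; have := c1 t _ hA.
  move=> nA; change (nbhs t (fun x : R => `[0, 1]%classic x -> A (1 - x))).
  apply: (@filterS R (nbhs t) _ _ _ _ nA) => x /= nA' /[!in_itv]/= /andP[x0 x1].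
  by apply: nA'; rewrite in_itv/= andbT subr_ge0.
by move=> t; apply: cvgM; [exact: cp|exact: cq].
Qed.

Lemma beta_kernel_ge0 p q t : 0 <= beta_kernel p q t.
Proof. by rewrite mulr_ge0 ?powR_ge0. Qed.

Lemma integral_gamma_kernel_shift p s : 0 <= p ->
  (\int[mu]_(u in `[s, +oo[) (gamma_kernel p (u - s)%R)%:E = Gamma_ext p)%E.
Proof.
move=> p0.
pose F (u : R) := u - s.
have dF (u : R) : is_derive u 1 F 1.
  by rewrite /F -[X in is_derive _ _ _ X]subr0; apply: is_deriveB.
have F1 : F^`()%classic = fun=> 1.
  by apply/funext => u; rewrite derive1E; exact: derive_val.
rewrite /Gamma_ext.
have -> : 0 = F s by rewrite /F subrr.
rewrite (@increasing_ge0_integration_by_substitutiony R F (gamma_kernel p)).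
- by apply: eq_integral => u _; rewrite !fctE F1 mulr1.
- by move=> x y _ _ xy; rewrite /F ltrD2r.
- by move=> x _; rewrite F1; exact: cvg_cst.
- by rewrite F1; exact: is_cvg_cst.
- by rewrite F1; exact: is_cvg_cst.
- split=> //.
  by apply: cvg_at_right_filter; apply: cvgB; [exact: cvg_id|exact: cvg_cst].
- by apply: cvg_addrr => //; exact: cvg_cst.
- by rewrite /F subrr; exact: gamma_kernel_within_continuous.
- by move=> x _; exact: gamma_kernel_ge0.
Qed.

(** The substitution $s = u l$ takes $u^p$ and $u^q$ out of the two powers and $u$ out of the
    differential. This computes the convolution of two powers. *)
Lemma integral_beta_scale p q u : 0 <= p -> 0 <= q -> 0 < u ->
  (\int[mu]_(s in `[0%R, u]) ((u - s) `^ p * s `^ q)%R%:E =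
   (u `^ (p + q + 1))%R%:E * Beta_ext p q)%E.
Proof.
move=> p0 q0 u0.
pose F (l : R) := l / u.
have dF (l : R) : is_derive l 1 F u^-1.
  rewrite /F; have := is_deriveZ u^-1 (is_derive_id l (1 : R^o)).
  rewrite [_ *: (1 : R^o)]mulr1; congr (is_derive _ _ _ _).
  by apply/funext => z; rewrite /F mulrC.
have F1 : F^`()%classic = fun=> u^-1.
  by apply/funext => l; rewrite derive1E; exact: derive_val.
have -> : Beta_ext p q = (\int[mu]_(t in `[F 0%R, F u]) (beta_kernel p q t)%:E)%E.
  by rewrite /F mul0r divff ?gt_eqF.
rewrite (@integration_by_substitution_increasing R F (beta_kernel p q)).
- rewrite -ge0_integralZl//=; last first.
  + by rewrite lee_fin powR_ge0.
  + by move=> x _; rewrite lee_fin F1 mulr_ge0 ?beta_kernel_ge0// invr_ge0 ltW.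
  + apply/measurable_EFinP; rewrite F1; apply: measurable_funTS.
    apply: measurable_funM => //.
    apply: measurable_funM; last first.
      apply: (measurableT_comp (measurable_powR q)); exact: mulrr_measurable.
    apply: (measurableT_comp (measurable_powR p)); apply: measurable_funB => //.
    exact: mulrr_measurable.
  apply: eq_integral => l; rewrite inE/= in_itv/= => /andP[l0 lu].
  rewrite -EFinM !fctE F1 /beta_kernel; congr (_%:E).
  have -> : (1 - l / u) = (u - l) * u^-1 by rewrite mulrBl divff ?gt_eqF.
  rewrite !powRM ?subr_ge0 ?invr_ge0 ?(ltW u0)//.
  rewrite -(powR_inv1 (ltW u0)) -!powRrM !mulN1r !powRD.
  all: try by rewrite (gt_eqF u0) implybT.
  rewrite !powRN powRr1 ?ltW//.
  have ? : u `^ p != 0 by rewrite gt_eqF// powR_gt0.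
  have ? : u `^ q != 0 by rewrite gt_eqF// powR_gt0.
  have ? : u != 0 by rewrite gt_eqF.
  by field; do ?(apply/andP; split).
- exact: ltW.
- by move=> x y _ _ xy; rewrite /F ltr_pM2r// invr_gt0.
- by move=> x _; rewrite F1; exact: cvg_cst.
- by rewrite F1; exact: is_cvg_cst.
- by rewrite F1; exact: is_cvg_cst.
- have cF : continuous F by move=> x; apply: cvgM; [exact: cvg_id|exact: cvg_cst].
  split=> //.
  + by apply: cvg_at_right_filter; exact: cF.
  + by apply: cvg_at_left_filter; exact: cF.
- by rewrite /F mul0r divff ?gt_eqF//; exact: beta_kernel_within_continuous.
Qed.
End gamma.

Section gamma_beta.
Context {R : realType}.
Local Notation mu := (@lebesgue_measure R).
Implicit Types p q s u : R.

(** Extension by zero puts all integrals on the whole line, ready for Tonelli's theorem, and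
    restricts the convolution of two kernels to $[0, u]$ automatically. *)
Let k p : R -> R := gamma_kernel p \_ `[0, +oo[.

Let k_ge0 p t : 0 <= k p t.
Proof. by rewrite /k patchE; case: ifP => // _; exact: gamma_kernel_ge0. Qed.

Let measurable_k p : measurable_fun setT (k p).
Proof.
by apply/(measurable_restrictT _ _).1 => //; exact: measurable_gamma_kernel.
Qed.

Let integral_k p : (\int[mu]_t (k p t)%:E = Gamma_ext p)%E.
Proof.
rewrite /Gamma_ext [RHS]integral_mkcond; apply: eq_integral => t _.
by rewrite /k restrict_EFin.
Qed.

Let integral_k_shift p s : 0 <= p -> (\int[mu]_u (k p (u - s)%R)%:E = Gamma_ext p)%E.
Proof.
move=> p0; rewrite -(integral_gamma_kernel_shift s p0) [RHS]integral_mkcond.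
apply: eq_integral => t _; rewrite /k /= !patchE.
have -> : (t - s \in `[0, +oo[%classic) = (t \in `[s, +oo[%classic).
  by apply/idP/idP; rewrite !inE/= !in_itv/= !andbT subr_ge0.
by case: ifP.
Qed.

(** The exponentials multiply to $e^{-u}$, constant in $s$, so only the convolution of two powers
    remains. For $u < 0$ one of the two arguments is always negative. *)
Let integral_k_conv p q u : 0 <= p -> 0 <= q ->
  (\int[mu]_s (k q s * k p (u - s))%R%:E =
   Beta_ext p q * (k (p + q + 1) u)%:E)%E.
Proof.
move=> p0 q0.
have [u0|u0] := ltP u 0.
  rewrite integral0_eq => [|s _].
    by rewrite /k patchE memNset ?mule0//= in_itv/= andbT leNgt u0.
  rewrite /k !patchE; case: ifPn => [|_]; last by rewrite mul0r.
  rewrite inE/= in_itv/= andbT => s0.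
  by rewrite memNset ?mulr0//= in_itv/= andbT subr_ge0 leNgt (lt_le_trans u0).
transitivity (\int[mu]_(s in `[0%R, u])
    ((expR (- u))%:E * ((u - s) `^ p * s `^ q)%R%:E))%E.
  rewrite [RHS]integral_mkcond; apply: eq_integral => s _.
  rewrite /k !patchE.
  have -> : (s \in `[0, u]%classic) =
      (s \in `[0, +oo[%classic) && (u - s \in `[0, +oo[%classic).
    by apply/idP/andP; rewrite !inE/= !in_itv/= !andbT subr_ge0 => /andP.
  case: ifP => /= _; last by rewrite mul0r.
  case: ifP => /= _; last by rewrite mulr0.
  rewrite -EFinM /gamma_kernel; congr (_%:E).
  have -> : expR (- u) = expR (- s) * expR (- (u - s)).
    by rewrite -expRD; congr expR; ring.
  by ring.
rewrite ge0_integralZl//=; last 2 first.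
- apply/measurable_EFinP; apply: measurable_funTS; apply: measurable_funM.
    apply: (measurableT_comp (measurable_powR p)); exact: measurable_funB.
  exact: measurable_powR.
- by move=> s _; rewrite lee_fin mulr_ge0 ?powR_ge0.
rewrite /k patchE ifT; last by rewrite inE/= in_itv/= andbT.
(* At $u = 0$ the integral is over a single point, and the right side vanishes because $p + q + 1 >
   0$. *)
move: u0; rewrite le_eqVlt => /predU1P[<-|u0].
  rewrite set_itv1 integral_set1 mule0 /gamma_kernel powR0 ?mul0r ?mule0//.
  by rewrite gt_eqF// ltr_wpDl// addr_ge0.
by rewrite integral_beta_scale// muleA -EFinM /gamma_kernel muleC mulrC.
Qed.

(** Tonelli's theorem for the double integral of [k q s * k p (u - s)]: integrating in $u$ first
    gives the product of the Gamma integrals, integrating in $s$ first gives the convolution. In the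
    extended reals, finiteness can be settled afterwards. *)
Lemma Gamma_ext_mul p q : 0 <= p -> 0 <= q ->
  (Gamma_ext p * Gamma_ext q = Beta_ext p q * Gamma_ext (p + q + 1))%E.
Proof.
move=> p0 q0.
have Beta_ge0 : (0 <= Beta_ext p q)%E.
  by apply: integral_ge0 => t _; rewrite lee_fin beta_kernel_ge0.
have Gamma_ge0 : (0 <= Gamma_ext p)%E.
  by apply: integral_ge0 => t _; rewrite lee_fin gamma_kernel_ge0.
have mK : measurable_fun setT (fun z : R * R => (k q z.1 * k p (z.2 - z.1))%:E).
  apply/measurable_EFinP; apply: measurable_funM.
    exact: measurableT_comp.
  by apply: measurableT_comp => //; exact: measurable_funB.
have := @fubini_tonelli _ _ _ _ R mu mu _ mK.
rewrite /=.
under eq_integral => s _.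
  under eq_integral do rewrite EFinM.
  rewrite ge0_integralZl//=; last 3 first.
  - by apply/measurable_EFinP; apply: measurableT_comp => //; exact: measurable_funB.
  - by move=> u _; rewrite lee_fin.
  - by rewrite lee_fin.
  rewrite integral_k_shift//; over.
rewrite ge0_integralZr//; last 2 first.
- by apply/measurable_EFinP; apply: measurable_k.
- by move=> s _; rewrite lee_fin.
rewrite integral_k muleC => ->.
  under eq_integral do rewrite integral_k_conv//.
  rewrite ge0_integralZl//; last 2 first.
  - by apply/measurable_EFinP; apply: measurable_k.
  - by move=> s _; rewrite lee_fin.
  by rewrite integral_k.
by move=> z; rewrite lee_fin mulr_ge0.
Qed.

Lemma Gamma_ext0 : Gamma_ext (0 : R) = 1%E.
Proof.
rewrite /Gamma_ext -[RHS](@integral_exponential_pdf R 1)//.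
rewrite integral_mkcond; apply: eq_integral => t _.
rewrite /exponential_pdf !patchE; case: ifPn => //= _.
by rewrite /gamma_kernel powRr0 !mul1r mulN1r.
Qed.

Lemma Beta_ext0 q : 0 <= q -> Beta_ext 0 q = ((q + 1)^-1)%:E.
Proof.
move=> q0.
have q1 : q + 1 != 0 by rewrite gt_eqF// ltr_wpDl.
transitivity (\int[mu]_(t in `[0%R, 1%R]) (t `^ q)%:E)%E.
  by apply: eq_integral => t _; rewrite /beta_kernel powRr0 mul1r.
rewrite (@continuous_FTC2 R _ (fun t => (q + 1)^-1 * t `^ (q + 1))).
- by rewrite powR1 powR0// mulr1 mulr0 sube0.
- exact: ltr01.
- apply: (@continuous_subspaceW R^o _ _ [set` `[0, +oo[%R]).
    exact: subset_itvl.
  exact: powR_within_continuous.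
- have cq := @powR_within_continuous R (q + 1) (addr_ge0 q0 ler01).
  split.
  + move=> t; rewrite in_itv/= => /andP[t0 _].
    by apply: derivableM => //; apply: derivable_powR; rewrite in_itv/= t0.
  + apply: cvgM; first exact: cvg_cst.
    by rewrite powR0//; apply: powR_cvg0; rewrite ltr_wpDl.
  + apply: cvgM; first exact: cvg_cst.
    by apply: cvg_at_left_filter; exact: powR_continuous.
- move=> t; rewrite in_itv/= => /andP[t0 _].
  rewrite derive1E.
  have := is_deriveZ ((q + 1)^-1) (is_derive1_powR (q + 1) t0).
  move=> /(@derive_val _ _ _ _ _ _ _) ->.
  by rewrite addrK /GRing.scale/= mulrA mulVf// mul1r.
Qed.

End gamma_beta.

Section gamma_values.
Context {R : realType}.
Local Notation mu := (@lebesgue_measure R).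
Implicit Types p q : R.

Lemma Gamma_ext_ge0 p : (0 <= Gamma_ext p)%E.
Proof. by apply: integral_ge0 => t _; rewrite lee_fin gamma_kernel_ge0. Qed.

(** The case $p = 0$ of [Gamma_ext_mul], where [Gamma_ext 0] and [Beta_ext 0 q] are explicit; this
    replaces an integration by parts. *)
Lemma Gamma_extS q : 0 <= q -> (Gamma_ext (q + 1) = (q + 1)%:E * Gamma_ext q)%E.
Proof.
move=> q0; have := Gamma_ext_mul (lexx 0) q0.
rewrite Gamma_ext0 mul1e Beta_ext0// add0r => ->.
by rewrite muleA -EFinM mulfV ?mul1e// gt_eqF// ltr_wpDl.
Qed.

(** The functional equation gives finiteness at the natural numbers, and $t^p \le 1 + t^n$ for $p
    \le n$ carries it to all $p \ge 0$. *)
Lemma Gamma_ext_fin_num p : 0 <= p -> Gamma_ext p \is a fin_num.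
Proof.
move=> p0.
have Gn n : Gamma_ext (n%:R : R) \is a fin_num.
  elim: n => [|n IH]; first by rewrite Gamma_ext0.
  by rewrite -natr1 Gamma_extS// fin_numM.
rewrite ge0_fin_numE ?Gamma_ext_ge0//.
pose n := (Num.truncn p).+1.
have pn : p <= n%:R by apply/ltW; exact: truncnS_gt.
have sumlty : (Gamma_ext (0 : R) + Gamma_ext (n%:R : R) < +oo)%E.
  by rewrite Gamma_ext0 -(fineK (Gn n)) -EFinD ltry.
apply: le_lt_trans sumlty.
rewrite /Gamma_ext -ge0_integralD//=; first last.
- by apply/measurable_EFinP; exact: measurable_gamma_kernel.
- by move=> t _; rewrite lee_fin gamma_kernel_ge0.
- by apply/measurable_EFinP; exact: measurable_gamma_kernel.
- by move=> t _; rewrite lee_fin gamma_kernel_ge0.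
apply: ge0_le_integral => //=.
- by move=> t _; rewrite lee_fin gamma_kernel_ge0.
- by apply/measurable_EFinP; exact: measurable_gamma_kernel.
- by apply/measurable_EFinP; apply: measurable_funD; exact: measurable_gamma_kernel.
- move=> t; rewrite in_itv/= andbT => t0; rewrite lee_fin /gamma_kernel -mulrDl.
  apply: ler_wpM2r; first exact: expR_ge0.
  rewrite powRr0; have [t1|t1] := leP t 1.
    apply: (@le_trans _ _ 1); last by rewrite lerDl powR_ge0.
    have := @ge0_ler_powR R p p0 t 1; rewrite powR1; apply; rewrite ?nnegrE//.
  apply: (@le_trans _ _ (t `^ n%:R)); last by rewrite lerDr.
  by apply: ler_powR => //; exact: ltW.
Qed.

Lemma Gamma_ext_gt0 p : 0 <= p -> (0 < Gamma_ext p)%E.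
Proof.
move=> p0; apply: (@lt_le_trans _ _ (\int[mu]_(t in `[1%R, 2%R]) (expR (-2))%:E)%E).
  rewrite integral_cst//= lebesgue_measure_itv/= lte_fin ltr1n/= -EFinD -EFinM.
  by rewrite lte_fin mulr_gt0 ?expR_gt0// subr_gt0 ltr1n.
apply: (@le_trans _ _ (\int[mu]_(t in `[1%R, 2%R]) (gamma_kernel p t)%:E)%E).
  apply: ge0_le_integral => //=.
  - by apply/measurable_EFinP; exact: measurable_gamma_kernel.
  - move=> t; rewrite in_itv/= => /andP[t1 t2]; rewrite lee_fin /gamma_kernel.
    rewrite -[leLHS]mul1r ler_pM ?expR_ge0// ?ler_expR ?lerN2//.
    by rewrite -(@powRr0 _ t); apply: ler_powR.
apply: ge0_subset_integral => //=.
- by apply/measurable_EFinP; exact: measurable_gamma_kernel.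
- by move=> t _; rewrite lee_fin gamma_kernel_ge0.
- by move=> t /=; rewrite !in_itv/= andbT => /andP[t1 _]; rewrite (le_trans _ t1).
Qed.

Lemma GammaE p : Gamma p = fine (Gamma_ext (p - 1)).
Proof.
rewrite /Gamma /Gamma_ext /Rintegral integral_itv_obnd_cbnd//.
by apply/measurable_EFinP; exact: measurable_gamma_kernel.
Qed.

(** [Gamma_ext_mul] combined with the functional equation at $p + q$, the source of the factor $p +
    q + 1$. In the application $p = \theta$, $q = \gamma\beta$ and $p + q + 1 = \gamma$. *)
Lemma Gamma_mul p q : 0 <= p -> 0 <= q ->
  Gamma (p + 1) * Gamma (q + 1) / Gamma (p + q + 1) =
  (p + q + 1) * fine (Beta_ext p q).
Proof.
move=> p0 q0; rewrite !GammaE !addrK.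
have pq0 : 0 <= p + q by rewrite addr_ge0.
have fG := Gamma_ext_fin_num.
have Gpq : 0 < fine (Gamma_ext (p + q)).
  by rewrite fine_gt0// Gamma_ext_gt0//= ltey_eq fG.
have /(congr1 fine) := Gamma_ext_mul p0 q0.
have fB : Beta_ext p q \is a fin_num.
  have /integrable_fin_num : mu.-integrable `[0, 1] (EFin \o beta_kernel p q).
    apply: continuous_compact_integrable; first exact: segment_compact.
    exact: beta_kernel_within_continuous.
  by apply.
rewrite Gamma_extS// !fineM ?fG//=; last by rewrite fin_numM// fG.
by move=> ->; rewrite mulrA mulfK ?gt_eqF// mulrC.
Qed.

End gamma_values.

(** * Regularly varying functions of positive index *)

Lemma near_pinfty_ge (R : realType) (X : R) : \forall x \near +oo, X <= x.
Proof. by apply: nbhs_pinfty_ge; exact: num_real. Qed.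

Lemma near_pinfty_gt (R : realType) (X : R) : \forall x \near +oo, X < x.
Proof. by apply: nbhs_pinfty_gt; exact: num_real. Qed.

Lemma near_pinftyP (R : realType) (P : R -> Prop) :
  (\forall x \near +oo, P x) <-> exists2 X : R, 0 < X & forall x, X <= x -> P x.
Proof.
split=> [[A [_ AP]]|[X X0 XP]].
  exists (Num.max A 0 + 1).
    by rewrite ltr_wpDl// le_max lexx orbT.
  move=> x; rewrite -lerBrDr ge_max => /andP[Ax _]; apply: AP.
  by rewrite (le_lt_trans Ax)// ltrBlDr ltrDl.
by near=> x; apply: XP; near: x; exact: near_pinfty_ge.
Unshelve. all: by end_near. Qed.

Lemma powR_gt1 (R : realType) (a r : R) : 1 < a -> 0 < r -> 1 < a `^ r.
Proof.
move=> a1 r0; have := @gt0_ltr_powR R r r0 1 a; rewrite powR1.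
by apply; rewrite ?nnegrE// ltW// (lt_trans _ a1).
Qed.

Section quasi_monotone.
Context {R : realType}.
Implicit Types (h : R -> R) (rho k : R).

Definition pos_continuous h :=
  {in `]0, +oo[, continuous h} /\ forall u, 0 < u -> 0 < h u.

Definition has_index rho h := forall lambda : R, 0 < lambda ->
  h (lambda * x) / h x @[x --> +oo] --> lambda `^ rho.

Lemma near_gt0 h : (forall u, 0 < u -> 0 < h u) -> \forall u \near +oo, 0 < h u.
Proof. by move=> h0; near=> u; apply: h0; near: u; exact: near_pinfty_gt.
Unshelve. all: by end_near. Qed.

Lemma has_index_lt rho h lambda c : (\forall u \near +oo, 0 < h u) ->
  has_index rho h -> 0 < lambda -> lambda `^ rho < c ->
  \forall x \near +oo, h (lambda * x) < c * h x.
Proof.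
move=> h0 hrho l0 lc; have hc : \forall x \near +oo, h (lambda * x) / h x < c by apply: cvgr_lt (hrho _ l0) _ lc.
near=> x; rewrite -ltr_pdivrMr; first by near: x; exact: hc.
by near: x.
Unshelve. all: by end_near. Qed.

Lemma has_index_gt rho h lambda c : (\forall u \near +oo, 0 < h u) ->
  has_index rho h -> 0 < lambda -> c < lambda `^ rho ->
  \forall x \near +oo, c * h x < h (lambda * x).
Proof.
move=> h0 hrho l0 lc; have hc : \forall x \near +oo, c < h (lambda * x) / h x by apply: cvgr_gt (hrho _ l0) _ lc.
near=> x; rewrite -ltr_pdivlMr; first by near: x.
by near: x.
Unshelve. all: by end_near. Qed.

(** For each single [t] the comparison holds for all large [a], with a threshold depending on [t].
    Baire's theorem makes the threshold uniform on some interval of exponents, and the limit at its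
    centre moves that interval to $0$. Each of the two steps costs a factor $\sqrt k$. *)
Lemma has_index_locally_monotone rho h k :
  pos_continuous h -> has_index rho h -> 0 < rho -> 1 < k ->
  exists2 d : R, 0 < d &
    \forall a \near +oo, forall t, 0 <= t <= d -> h a <= k * h (expR t * a).
Proof.
move=> [ch h0] hrho rho0 k1.
pose r := Num.sqrt k.
have k0 : 0 < k by apply: lt_trans k1.
have r1 : 1 < r by rewrite -(sqrtr1 R) ltr_sqrt.
have r0 : 0 < r by apply: lt_trans r1.
(* The threshold sits inside [E n a], so that the intersection runs over all [a] and is closed by
   the continuity of [h]. *)
pose E (n : nat) (a : R) : set R^o :=
  [set t | n.+1%:R <= a -> expR t `^ rho * h a <= r * h (expR t * a)].
pose F n : set R^o := ~` \bigcap_a E n a.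
have oF n : open (F n).
  apply: closed_openC; apply: closed_bigI => a _.
  have [na|na] := leP n.+1%:R a; last first.
    rewrite (_ : E n a = setT); first exact: closedT.
    by apply/seteqP; split => // t _ /(lt_le_trans na); rewrite ltxx.
  have a0 : 0 < a by apply: lt_le_trans na.
  rewrite (_ : E n a = (fun t => r * h (expR t * a) - expR t `^ rho * h a) @^-1`
      [set x | 0 <= x]); last first.
    apply/seteqP; split => t; rewrite /E /= subr_ge0; first by apply.
    by [].
  apply: preimage_closed => [t _|]; last exact: closed_ge.
  have ch1 : h (expR t * a) @[t --> t] --> h (expR t * a).
    apply: (@cvg_comp _ _ _ (fun t : R => expR t * a) h).
      by apply: cvgMr_tmp; exact: continuous_expR.
    by apply: ch; rewrite in_itv/= andbT mulr_gt0 ?expR_gt0.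
  have cp1 : expR t `^ rho @[t --> t] --> expR t `^ rho.
    apply: (@cvg_comp _ _ _ (@expR R) (fun x => x `^ rho)).
      exact: continuous_expR.
    exact/powR_continuous/expR_gt0.
  exact: cvgB (cvgM (cvg_cst r) ch1) (cvgM cp1 (cvg_cst (h a))).
(* If every [F n] were dense, Baire's theorem would give a [t] lying in all of them, against the
   limit of $h(e^t a)/h(a)$. *)
have [n] : exists n, ~ dense (F n).
  apply/existsNP => dF.
  have /(_ setT) := @Baire R R^o F (fun n => conj (oF n) (dF n)).
  case=> [||t [_ Ft]]; [by exists 0|exact: openT|].
  have : expR t `^ rho / r < expR t `^ rho.
    by rewrite ltr_pdivrMr// ltr_pMr// powR_gt0 ?expR_gt0.
  move=> /(has_index_gt (near_gt0 h0) hrho (expR_gt0 t)) /near_pinftyP[X X0 hX].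
  have [m Xm] : exists m : nat, X <= m.+1%:R.
    by exists (Num.truncn X); apply/ltW/truncnS_gt.
  apply: (Ft m I) => a _ ma.
  have := ltW (hX a (le_trans Xm ma)).
  by rewrite mulrAC ler_pdivrMr// mulrC [in leRHS]mulrC.
move=> /existsNP[U] /not_implyP[[c Oc]] /not_implyP[oU UF].
have OE t : U t -> forall a, E n a t.
  move=> Ot a; apply: contrapT => Et; apply: UF; exists t; split => // /(_ a I).
  exact: Et.
have := oU; rewrite openE => /(_ _ Oc) /nbhs_ballP[e /= e0 eO].
exists (e / 2); first by rewrite divr_gt0.
have : expR c `^ rho < r * expR c `^ rho.
  by rewrite ltr_pMl// powR_gt0 ?expR_gt0.
move=> /(has_index_lt (near_gt0 h0) hrho (expR_gt0 c)) /near_pinftyP[X X0 hX].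
have ec0 := expR_gt0 c.
near=> a.
have Xa : expR c * X <= a by near: a; exact: near_pinfty_ge.
have na : expR c * n.+1%:R <= a by near: a; exact: near_pinfty_ge.
move=> t /andP[t0 te].
(* Seen from [a'], the points [a] and [expR t * a] have exponents [c] and [c + t]: the first is
   handled by the limit at $e^c$, the second lies in the uniform interval. *)
pose a' := expR (- c) * a.
have aE : a = expR c * a' by rewrite mulrA -expRD subrr expR0 mul1r.
have Xa' : X <= a' by rewrite -ler_pdivrMl ?expR_gt0// -expRN opprK.
have na' : n.+1%:R <= a' by rewrite -ler_pdivrMl ?expR_gt0// -expRN opprK.
have Oct : U (c + t).
  apply: eO; rewrite /ball/= opprD addrA subrr sub0r normrN ger0_norm//.
  by rewrite (le_lt_trans te)// ltr_pdivrMr// ltr_pMr// ltr1n.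
have := OE (c + t) Oct a' na'.
have -> : expR (c + t) * a' = expR t * a by rewrite aE mulrA -expRD addrC.
have /ltW := hX _ Xa'; rewrite -aE => h1 h2.
have -> : k = r * r by rewrite -expr2 sqr_sqrtr// ltW.
apply: (le_trans h1); rewrite -!mulrA (ler_pM2l r0); apply: le_trans h2.
rewrite ler_pM2r; last by apply: h0; apply: lt_le_trans Xa'.
by apply: ge0_ler_powR; rewrite ?nnegrE ?expR_ge0 ?ler_expR ?lerDl// ltW.
Unshelve. all: by end_near. Qed.

(** As $1 < e^{d\rho}$, a full step from [a] to [expR d * a] increases [h] with no constant lost.
    The factor [k] is paid only once, on the last incomplete step. *)
Lemma has_index_quasi_monotone rho h k :
  pos_continuous h -> has_index rho h -> 0 < rho -> 1 < k ->
  exists2 X : R, 0 < X & forall a b, X <= a -> a <= b -> h a <= k * h b.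
Proof.
move=> ch hrho rho0 k1.
have [d d0 loc] := has_index_locally_monotone ch hrho rho0 k1.
have w1 : 1 < expR d by rewrite expR_gt1.
have : 1 < expR d `^ rho.
  exact: powR_gt1.
move=> /(has_index_gt (near_gt0 ch.2) hrho (expR_gt0 d)) step.
have [X X0 XP] := (near_pinftyP _).1 (filterI loc step).
have k0 : 0 < k by apply: lt_trans k1.
have chain m : forall a b, X <= a -> a <= b -> b <= expR d ^+ m * a ->
    h a <= k * h b.
  elim: m => [|m IH] a b Xa ab bm.
    have -> : b = a by apply/eqP; rewrite eq_le ab andbT -[leRHS]mul1r.
    by rewrite ler_peMl ?ltW// ch.2// (lt_le_trans X0).
  have a0 : 0 < a by apply: lt_le_trans Xa.
  have [loca stepa] := XP a Xa.
  have [bw|wb] := leP b (expR d * a).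
    have ba : b / a = expR (ln (b / a)).
      by rewrite lnK// posrE divr_gt0// (lt_le_trans a0).
    have := loca (ln (b / a)); rewrite -ba divfK ?gt_eqF//; apply.
    rewrite ln_ge0 ?ler_pdivlMr ?mul1r//=.
    by rewrite -(expRK d) ler_ln ?posrE ?expR_gt0 ?divr_gt0// ?(lt_le_trans a0)// ler_pdivrMr.
  have := stepa; rewrite mul1r => /ltW/le_trans; apply.
  apply: IH => //; last 2 first.
  - exact: ltW.
  - by rewrite mulrA -exprSr.
  by rewrite (le_trans Xa)// ler_peMl// ltW.
exists X => // a b Xa ab.
have a0 : 0 < a by apply: lt_le_trans Xa.
(* Enough steps to reach [b], since $(e^d)^m \ge 1 + dm \ge b/a$. *)
pose m := (Num.truncn (b / a / d)).+1.
apply: (chain m) => //; rewrite -ler_pdivrMr//.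
have bm : b / a <= d * m%:R.
  by rewrite [leRHS]mulrC -ler_pdivrMr//; apply/ltW/truncnS_gt.
rewrite -expRM_natr; apply: le_trans (expR_ge1Dx _).
by rewrite (le_trans bm)// lerDr.
Qed.

(** Along the points $2^n Z$ the function grows at least geometrically with ratio $c > 1$; elsewhere
    quasi-monotonicity loses at most a factor $2$. *)
Lemma has_index_pinfty rho h : pos_continuous h -> has_index rho h -> 0 < rho ->
  h u @[u --> +oo] --> +oo.
Proof.
move=> ch hrho rho0.
have n12 : 1 < 2 :> R by rewrite ltr1n.
have [X X0 qm] := has_index_quasi_monotone ch hrho rho0 n12.
have c1 : 1 < 2 `^ rho :> R.
  exact: powR_gt1.
have [c c1' c2] : exists2 c : R, 1 < c & c < 2 `^ rho.
  exists ((1 + 2 `^ rho) / 2); lra.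
have c0 : 0 < c by apply: lt_trans c1'.
have n02 : 0 < 2 :> R by rewrite ltr0n.
have [Y Y0 hY] := (near_pinftyP _).1 (has_index_gt (near_gt0 ch.2) hrho n02 c2).
pose Z := Num.max X Y.
have Z0 : 0 < Z by rewrite lt_max X0.
have grow n : c ^+ n * h Z <= h (2 ^+ n * Z).
  elim: n => [|n IH]; first by rewrite !expr0 !mul1r.
  rewrite !exprS -!mulrA; apply: (@le_trans _ _ (c * h (2 ^+ n * Z))).
    by rewrite ler_pM2l.
  apply/ltW/hY; rewrite (@le_trans _ _ Z) ?le_max ?lexx ?orbT//.
  by rewrite ler_peMl ?(ltW Z0)// exprn_ege1// ler1n.
have bern m : 1 + m%:R * (c - 1) <= c ^+ m.
  elim: m => [|m IH]; first by rewrite mul0r addr0 expr0.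
  rewrite exprS; apply: (@le_trans _ _ (c * (1 + m%:R * (c - 1)))); last first.
    by rewrite ler_pM2l.
  rewrite -natr1 -subr_ge0 [leRHS](_ : _ = m%:R * (c - 1) ^+ 2); last by ring.
  by rewrite mulr_ge0// sqr_ge0.
apply/cvgryPge => A.
pose n := (Num.truncn (2 * A / h Z / (c - 1))).+1.
have hZ : 0 < h Z by apply: ch.2.
have An : 2 * A <= c ^+ n * h Z.
  rewrite -ler_pdivrMr//; apply: le_trans (bern n).
  have : 2 * A / h Z <= n%:R * (c - 1).
    by rewrite -ler_pdivrMr ?subr_gt0//; apply/ltW/truncnS_gt.
  by move=> /le_trans; apply; rewrite lerDr.
near=> u.
have : h (2 ^+ n * Z) <= 2 * h u.
  apply: qm; last by near: u; exact: near_pinfty_ge.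
  rewrite (@le_trans _ _ Z) ?le_max ?lexx//.
  by rewrite ler_peMl ?(ltW Z0)// exprn_ege1// ler1n.
move=> /(le_trans (grow n)) /(le_trans An).
by rewrite ler_pM2l.
Unshelve. all: by end_near. Qed.

End quasi_monotone.

(** * Comparing f with u / f u *)

Definition quasi_increasing (R : realType) (h : R -> R) : Prop :=
  forall k : R, 1 < k ->
    exists2 X : R, 0 < X & forall a b, X <= a -> a <= b -> h a <= k * h b.

Section compare.
Context {R : realType}.
Variables (f : R -> R) (beta : R).
Hypothesis beta01 : 0 <= beta < 1.
Hypothesis fc : pos_continuous f.
Hypothesis fb : has_index beta f.
Hypothesis fq : quasi_increasing f.

Let g (u : R) := u / f u.
Let sigma := 1 - beta.

Lemma ratio_pos_continuous : pos_continuous g.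
Proof.
case: fc => cf f0; split=> [u u0|u u0]; last by rewrite divr_gt0// f0.
apply: cvgM; first exact: cvg_id.
apply: cvgV; last exact: cf.
by rewrite gt_eqF// f0//; move: u0; rewrite in_itv/= andbT.
Qed.

Lemma ratio_has_index : has_index sigma g.
Proof.
move=> l l0.
have -> : l `^ sigma = l * (l `^ beta)^-1.
  by rewrite powRB ?(gt_eqF l0) ?implybT// powRr1// ltW.
have : l * (f (l * x) / f x)^-1 @[x --> +oo] --> l * (l `^ beta)^-1.
  apply: cvgMl_tmp; apply: cvgV; last exact: fb.
  by rewrite gt_eqF// powR_gt0.
apply: cvg_trans; apply: near_eq_cvg; near=> x.
have x0 : 0 < x by near: x; exact: near_pinfty_gt.
have fx := fc.2 _ x0; have flx := fc.2 _ (mulr_gt0 l0 x0).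
by rewrite /g; field; rewrite !gt_eqF.
Unshelve. all: by end_near. Qed.

Lemma ratio_quasi_increasing : quasi_increasing g.
Proof.
move=> k; apply: has_index_quasi_monotone ratio_has_index _.
  exact: ratio_pos_continuous.
by rewrite subr_gt0; case/andP: beta01.
Qed.

(** The tolerance $k = d^{-\sigma/3}$ is such that three losses of [k] cost exactly $d^{-\sigma}$
    and two cost at most $d^{-1}$. The former closes the contradictory case of the comparison
    lemmas, the latter the direct one. *)
Let powd (d : R) : 0 < d < 1 ->
  let k := d `^ (- (sigma / 3)) in
  [/\ 1 < k, k ^+ 3 * d `^ sigma = 1, d * k ^+ 2 <= 1 & d <= d `^ beta].
Proof.
move=> /andP[d0 d1] k.
have [b0 b1] := andP beta01.
have k1 : 1 < k.
  rewrite /k powRN invf_gt1 ?powR_gt0//.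
  have := @gt0_ltr_powR R (sigma / 3) _ d 1; rewrite powR1; apply.
  - by rewrite divr_gt0// subr_gt0.
  - by rewrite nnegrE ltW.
  - by rewrite nnegrE.
  - exact: d1.
have d01 : 0 < d <= 1 by rewrite d0 ltW.
split => //.
- rewrite /k -powR_mulrn ?powR_ge0// -powRrM -powRD; last by rewrite (gt_eqF d0) implybT.
  by rewrite (_ : _ + _ = 0) ?powRr0//; field.
- rewrite /k -powR_mulrn ?powR_ge0// -powRrM -{1}(powRr1 (ltW d0)) -powRD; last first.
    by rewrite (gt_eqF d0) implybT.
  rewrite -[leRHS](powRr0 d) ger_powR// /sigma; lra.
- by rewrite -{1}(powRr1 (ltW d0)) ger_powR// ltW.
Qed.

(** If $a \ge d e b$, the bound on [f] follows from its quasi-monotonicity and its index. If $a < d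
    e b$, the same two facts for [g] make [g a] too small: three factors [k] against $d^\sigma$ give
    a strict inequality of a quantity with itself. It matters that [k] does not depend on [e],
    because one almost minimum has to serve all points of a grid. *)
Lemma compare_lower (d : R) : 0 < d < 1 -> exists2 k, 1 < k &
  forall e, 0 < e -> exists2 X, 0 < X & forall a b, X <= a -> X <= b ->
    e `^ sigma * g b <= k * g a -> d ^+ 2 * e `^ beta * f b <= f a.
Proof.
move=> /[dup] /andP[d0 d1] /powd[]; set k := d `^ _ => k1 k3 k2 db.
have k0 : 0 < k by apply: lt_trans k1.
exists k => // e e0.
have r0 : 0 < d * e by rewrite mulr_gt0.
have [X1 X10 qf] := fq k1.
have [X2 X20 qg] := ratio_quasi_increasing k1.
have hg : (d * e) `^ sigma < k * (d * e) `^ sigma.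
  by rewrite ltr_pMl// powR_gt0.
have hf : (d * e) `^ beta / k < (d * e) `^ beta.
  by rewrite ltr_pdivrMr// ltr_pMr// powR_gt0.
have [X3 X30 hg3] := (near_pinftyP _).1
  (has_index_lt (near_gt0 ratio_pos_continuous.2) ratio_has_index r0 hg).
have [X4 X40 hf4] := (near_pinftyP _).1 (has_index_gt (near_gt0 fc.2) fb r0 hf).
exists (X1 + X2 + X3 + X4 + (X1 / (d * e))); first by rewrite !addr_gt0// divr_gt0.
have X1d : 0 < X1 / (d * e) by rewrite divr_gt0.
move=> a b Xa Xb eg.
have b0 : 0 < b by lra.
have a0 : 0 < a by lra.
have X1b : X1 <= d * e * b.
  by rewrite mulrC -ler_pdivrMr//; lra.
have fb0 := fc.2 _ b0.
have [dea|adb] := leP (d * e * b) a.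
  have h1 := qf _ _ X1b dea.
  have /hf4/ltW h2 : X4 <= b by lra.
  have {h1 h2} := le_trans h2 h1.
  rewrite mulrAC ler_pdivrMr// (powRM _ (ltW d0) (ltW e0)) => h.
  have : d * (d `^ beta * e `^ beta * f b) <= f a.
    apply: (le_trans (ler_wpM2l (ltW d0) h)).
    rewrite [leLHS](_ : _ = d * k ^+ 2 * f a); last by ring.
    by rewrite ler_piMl// ltW// fc.2.
  apply: le_trans; rewrite expr2 -!mulrA ler_pM2l//.
  by apply: ler_wpM2r => //; rewrite mulr_ge0 ?powR_ge0// ltW.
exfalso.
have X2a : X2 <= a by lra.
have h1 := qg _ _ X2a (ltW adb).
have /hg3 h2 : X3 <= b by lra.
have gb0 : 0 < g b by apply: ratio_pos_continuous.2.
have : e `^ sigma * g b < k * (k * (k * (d * e) `^ sigma * g b)).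
  apply: (le_lt_trans eg); rewrite ltr_pM2l//; apply: (le_lt_trans h1).
  by rewrite ltr_pM2l.
rewrite (powRM _ (ltW d0) (ltW e0)).
rewrite [ltRHS](_ : _ = k ^+ 3 * d `^ sigma * (e `^ sigma * g b)); last by ring.
by rewrite k3 mul1r ltxx.
Qed.

(** The mirror image of [compare_lower], with the two cases separated at $a = (e/d) b$. *)
Lemma compare_upper (d : R) : 0 < d < 1 -> exists2 k, 1 < k &
  forall e, 0 < e -> exists2 X, 0 < X & forall a b, X <= a -> X <= b ->
    g a <= k * e `^ sigma * g b -> d ^+ 2 * f a <= e `^ beta * f b.
Proof.
move=> /[dup] /andP[d0 d1] /powd[]; set k := d `^ _ => k1 k3 k2 db.
have k0 : 0 < k by apply: lt_trans k1.
exists k => // e e0.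
have r0 : 0 < e / d by rewrite divr_gt0.
have [X1 X10 qf] := fq k1.
have [X2 X20 qg] := ratio_quasi_increasing k1.
have hf : (e / d) `^ beta < k * (e / d) `^ beta.
  by rewrite ltr_pMl// powR_gt0.
have hg : (e / d) `^ sigma / k < (e / d) `^ sigma.
  by rewrite ltr_pdivrMr// ltr_pMr// powR_gt0.
have [X3 X30 hg3] := (near_pinftyP _).1
  (has_index_gt (near_gt0 ratio_pos_continuous.2) ratio_has_index r0 hg).
have [X4 X40 hf4] := (near_pinftyP _).1 (has_index_lt (near_gt0 fc.2) fb r0 hf).
have X2d : 0 < X2 / (e / d) by rewrite divr_gt0.
exists (X1 + X2 + X3 + X4 + (X2 / (e / d))); first by rewrite !addr_gt0.
move=> a b Xa Xb eg.
have b0 : 0 < b by lra.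
have a0 : 0 < a by lra.
have X2b : X2 <= e / d * b.
  by rewrite mulrC -ler_pdivrMr//; lra.
have fb0 := fc.2 _ b0.
have powV r : (d^-1) `^ r = (d `^ r)^-1.
  by rewrite -(powR_inv1 (ltW d0)) -powRrM mulN1r powRN.
have powE r : (e / d) `^ r = e `^ r / d `^ r.
  by rewrite powRM ?powV ?invr_ge0 ?(ltW d0) ?(ltW e0).
have pd r : 0 < d `^ r by exact: powR_gt0.
have [ade|dba] := leP a (e / d * b).
  have X1a : X1 <= a by lra.
  have h1 := qf _ _ X1a ade.
  have /hf4/ltW h2 : X4 <= b by lra.
  have {h1 h2} : f a <= k * (k * (e / d) `^ beta * f b).
    by apply: (le_trans h1); rewrite ler_pM2l.
  rewrite powE (_ : k * _ = k ^+ 2 * (e `^ beta * f b) / d `^ beta); last by ring.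
  rewrite ler_pdivlMr// => h.
  have ef0 : 0 < e `^ beta * f b by rewrite mulr_gt0// powR_gt0.
  have {}h := ler_wpM2l (ltW d0) h.
  apply: (@le_trans _ _ (d * (f a * d `^ beta))).
    rewrite expr2 -mulrA ler_pM2l// mulrC ler_pM2l//; exact: fc.2.
  by apply: (le_trans h); rewrite [leLHS]mulrA; exact: ler_piMl (ltW ef0) k2.
exfalso.
have h1 := qg _ _ X2b (ltW dba).
have /hg3 h2 : X3 <= b by lra.
have gb0 : 0 < g b by apply: ratio_pos_continuous.2.
have : (e / d) `^ sigma / k * g b < k * (k * e `^ sigma * g b).
  by apply: (lt_le_trans h2); apply: (le_trans h1); rewrite ler_pM2l.
rewrite powE mulrAC ltr_pdivrMr// mulrAC ltr_pdivrMr//.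
rewrite [ltRHS](_ : _ = k ^+ 3 * d `^ sigma * (e `^ sigma * g b)); last by ring.
by rewrite k3 mul1r ltxx.
Qed.

End compare.

(** * Almost minima over the past *)

Section almost_running_min.
Context {R : realType}.
Implicit Types (q : R -> R) (k v : R).

(** [A] is the set of positive eventual lower bounds. If it is inhabited, its supremum [L] is the
    lower limit of [q], and late times with [q] close to [L] are almost minimal over a late enough
    past. If it is empty, [q] gets arbitrarily small, and near-minimizers over longer and longer
    intervals move off to infinity. *)
Lemma almost_running_min q (T0 : R) k v :
  (forall T, exists2 m : R, 0 < m & forall s, T0 <= s <= T -> m <= q s) ->
  1 < k -> 0 < v -> (forall T, exists2 t, T <= t & q t < v) ->
  exists2 S, T0 <= S & forall T, exists t,
    [/\ T <= t, S <= t, q t <= k * v & forall s, S <= s <= t -> q t <= k * q s].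
Proof.
move=> qlb k1 v0 qv.
have k0 : 0 < k by apply: lt_trans k1.
pose A := [set c : R | 0 < c /\ exists2 S, T0 <= S & forall s, S <= s -> c <= q s].
have [[c0 Ac0]|A0] := pselect (A !=set0).
  have ubA : ubound A v.
    move=> c [_ [S _ cS]]; have [t St /ltW] := qv S.
    by apply: le_trans; exact: cS.
  have supA : has_sup A by split; [exists c0|exists v].
  pose L := sup A.
  have L0 : 0 < L.
    by apply: (@lt_le_trans _ _ c0); [case: Ac0|exact: @ub_le_sup _ _ (proj2 supA) _ Ac0].
  have Lv : L <= v by apply: ge_sup => //; exists c0.
  pose r := Num.sqrt k.
  have r1 : 1 < r by rewrite -(sqrtr1 R) ltr_sqrt.
  have r0 : 0 < r by apply: lt_trans r1.
  have rr : k = r * r by rewrite -expr2 sqr_sqrtr// ltW.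
  have e0 : 0 < L - L / r by rewrite subr_gt0 ltr_pdivrMr// ltr_pMr.
  have [c Ac] := sup_adherent e0 supA; rewrite opprB addrC subrK => Lc.
  case: Ac => cp [S T0S cS]; exists S => // T.
  (* [L * r] exceeds the supremum, so [q] falls below it at arbitrarily late times, while [q] is at
     least [L / r] after [S]. *)
  have : ~ A (L * r).
    move=> /(@ub_le_sup _ _ (proj2 supA)); apply/negP; rewrite -ltNge.
    by rewrite ltr_pMr.
  move=> /not_andP[|/forall2NP /(_ (Num.max T S))]; first by rewrite mulr_gt0.
  move=> [|/existsNP[t /not_implyP[+ /negP]]].
    by rewrite le_max T0S orbT.
  rewrite ge_max -ltNge => /andP[Tt St] /ltW qL.
  exists t; split => //.
    apply: (le_trans qL); rewrite rr mulrC -mulrA ler_pM2l//.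
    by rewrite (le_trans Lv)// ler_peMl// ltW.
  move=> s /andP[Ss _]; apply: (le_trans qL).
  rewrite rr mulrC -mulrA ler_pM2l//.
  by rewrite mulrC -ler_pdivrMr//; apply: (le_trans (ltW Lc)); exact: cS.
exists T0 => // T.
have [m m0 mq] := qlb T.
(* Staying below [m] forces the near-minimizer beyond [T]; staying below [v] gives the bound on its
   value. *)
pose m' := Num.min m v.
have m'0 : 0 < m' by rewrite lt_min m0.
have [tau [taut T0tau qtau]] : exists tau, [/\ T <= tau, T0 <= tau & q tau < m' / k].
  apply: contrapT => h; apply: A0; exists (m' / k); split; first by rewrite divr_gt0.
  exists (Num.max T T0); first by rewrite le_max lexx orbT.
  move=> s; rewrite ge_max => /andP[Ts T0s]; rewrite leNgt; apply/negP => qs.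
  by apply: h; exists s.
have [m2 m20 m2q] := qlb tau.
pose I := [set q s | s in [set s | T0 <= s <= tau]].
have qtauI : I (q tau) by exists tau => //=; rewrite T0tau lexx.
have lbI : has_lbound I by exists m2 => _ [s /= sT <-]; exact: m2q.
have infI : has_inf I by split => //; exists (q tau).
have i0 : 0 < inf I.
  apply: (lt_le_trans m20); apply: lb_le_inf; first by exists (q tau).
  by move=> _ [s /= sT <-]; exact: m2q.
have e0 : 0 < k * inf I - inf I by rewrite subr_gt0 ltr_pMl.
have [_ [t /= /andP[T0t ttau] <-]] := inf_adherent e0 infI.
rewrite addrC subrK => qt.
have kim : k * inf I < m'.
  rewrite mulrC -ltr_pdivlMr//; apply: le_lt_trans qtau.
  exact: ge_inf.
exists t; split => //.
- rewrite leNgt; apply/negP => tT.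
  have := mq t; rewrite T0t (ltW tT) => /(_ isT).
  rewrite leNgt => /negP; apply; apply: (lt_trans qt); apply: (lt_le_trans kim).
  by rewrite ge_min lexx.
- apply/ltW/(lt_trans qt)/(lt_le_trans kim).
  apply: (@le_trans _ _ v); first by rewrite ge_min lexx orbT.
  by rewrite ler_peMl// ltW.
- move=> s /andP[T0s st]; apply: (le_trans (ltW qt)); rewrite ler_pM2l//.
  by apply: ge_inf => //; exists s => //=; rewrite T0s (le_trans st).
Qed.

End almost_running_min.

(** * Eventual properties and multiplicative estimates *)

Lemma not_near_pinfty (R : realType) (P : R -> Prop) :
  ~ (\forall x \near +oo, P x) -> forall T : R, exists2 t, T <= t & ~ P t.
Proof.
move=> nP T; apply: contrapT => h; apply: nP; near=> t.
apply: contrapT => nPt; apply: h; exists t => //; near: t; exact: near_pinfty_ge.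
Unshelve. all: by end_near. Qed.

Lemma near_forall_ltn (R : realType) (n : nat) (P : nat -> R -> Prop) :
  (forall i, (i < n)%N -> \forall t \near +oo, P i t) ->
  \forall t \near +oo, forall i, (i < n)%N -> P i t.
Proof.
elim: n => [|n IH] nP; first by apply: nearW => t i.
have h1 := nP n (ltnSn n).
have h2 : \forall t \near +oo, forall i, (i < n)%N -> P i t.
  by apply: IH => i ni; apply: nP; exact: ltnW.
near=> t; move=> i; rewrite ltnS leq_eqVlt => /predU1P[->|].
  by near: t.
by move: i; near: t.
Unshelve. all: by end_near. Qed.

Lemma pos_continuous_within (R : realType) (h : R -> R) (a b : R) :
  pos_continuous h -> 0 < a -> {within `[a, b], continuous h}.
Proof.
move=> [ch _] a0; apply: continuous_in_subspaceT => u.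
rewrite inE/= in_itv/= => /andP[au _]; apply: ch.
by rewrite in_itv/= andbT (lt_le_trans a0).
Qed.

(** Convergence to a positive limit in multiplicative form. All estimates below lose powers of a
    factor $d < 1$, and the exponent [m] is the total loss. *)
Lemma cvg_factor_squeeze (R : realType) (h : R -> R) (c : R) (m : nat) : 0 < c ->
  (forall d, 0 < d < 1 -> \forall t \near +oo, d ^+ m * c <= h t) ->
  (forall d, 0 < d < 1 -> \forall t \near +oo, d ^+ m * h t <= c) ->
  h t @[t --> +oo] --> c.
Proof.
move=> c0 hl hu; apply/cvgrPdist_le => e e0.
(* With $d = 1 - a$, Bernoulli's inequality gives $d^m \ge 1 - ma$, and this [a] makes $ma(c + e)
   \le e$. *)
pose a := e / (m.+1%:R * (c + e)).
have ce : 0 < c + e by exact: addr_gt0.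
have m0 : 0 < m.+1%:R :> R by rewrite ltr0n.
have a0 : 0 < a by rewrite divr_gt0// mulr_gt0.
have a1 : a < 1.
  rewrite ltr_pdivrMr ?mulr_gt0// mul1r; apply: (@lt_le_trans _ _ (c + e)).
    by rewrite ltrDr.
  by rewrite ler_peMl ?(ltW ce)// ler1n.
have d01 : 0 < 1 - a < 1 by rewrite subr_gt0 a1 gtrBl.
have bern n : 1 - n%:R * a <= (1 - a) ^+ n.
  elim: n => [|n IH]; first by rewrite mul0r subr0 expr0.
  have a1' : 0 <= 1 - a by rewrite subr_ge0 ltW.
  rewrite exprS; apply: le_trans (ler_wpM2l a1' IH).
  rewrite -natr1 -subr_ge0 [leRHS](_ : _ = n%:R * a ^+ 2); last by ring.
  by rewrite mulr_ge0// sqr_ge0.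
have ma : m%:R * a * (c + e) <= e.
  rewrite /a [leLHS](_ : _ = e * (m%:R / m.+1%:R)); last first.
    by field; rewrite !gt_eqF.
  by rewrite ler_piMr ?(ltW e0)// ler_pdivrMr// mul1r ler_nat.
have ma0 : 0 <= m%:R * a by rewrite mulr_ge0// ltW.
near=> t.
have ht : (1 - a) ^+ m * c <= h t by near: t; exact: hl.
have th : (1 - a) ^+ m * h t <= c by near: t; exact: hu.
have h0 : 0 <= h t.
  by apply: le_trans ht; rewrite mulr_ge0 ?exprn_ge0 ?subr_ge0// ltW.
have h1 := ler_wpM2r (ltW c0) (bern m).
have h2 := ler_wpM2r h0 (bern m).
rewrite ler_distlC; apply/andP; split; first by nra.
rewrite leNgt; apply/negP => cht.
have : (1 - m%:R * a) * h t <= c by apply: le_trans th.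
have : 0 < 1 - m%:R * a.
  rewrite subr_gt0 -(ltr_pM2r ce) mul1r; apply: (le_lt_trans ma).
  by rewrite ltrDr.
move=> y0; have : (1 - m%:R * a) * (c + e) < (1 - m%:R * a) * h t by rewrite ltr_pM2l.
lra.
Unshelve. all: by end_near. Qed.

(** The square root of the smaller of [k] and $1/d$. Two losses of [r] then fit into the tolerance
    [k], and a single one is absorbed by a spare factor [d]. *)
Lemma small_factor (R : realType) (d k : R) : 0 < d < 1 -> 1 < k -> exists r : R, [/\ 1 < r, r ^+ 2 <= k & r * d < 1].
Proof.
move=> /andP[d0 d1] k1.
pose m := Num.min k d^-1.
have m1 : 1 < m by rewrite lt_min k1 invf_gt1.
have m0 : 0 <= m by rewrite ltW// (lt_trans _ m1).
have r1 : 1 < Num.sqrt m by rewrite -(sqrtr1 R) ltr_sqrt// (lt_trans _ m1).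
have r2 := sqr_sqrtr m0.
exists (Num.sqrt m); split => //; first by rewrite r2 ge_min lexx.
rewrite -ltr_pdivlMr// mul1r.
apply: (@lt_le_trans _ _ m); last by rewrite ge_min lexx orbT.
by rewrite -[ltRHS]r2 expr2 ltr_pMr// (lt_trans _ r1).
Qed.

(* Vanishes at [0], unlike [powR], for which [0 `^ 0 = 1]. *)
Definition pos_powR (R : realType) (p l : R) : R := if 0 < l then l `^ p else 0.

Section riemann_sums.
Context {R : realType}.
Variables (p q : R) (n : nat).

(** On each cell the decreasing factor is sampled at the right end and the increasing one at the
    left end. Through [pos_powR] the first and last terms vanish: there regular variation says
    nothing, as the argument of [x] or of [M] need not be large. *)
Definition lower_beta_sum : R := n%:R^-1 * \sum_(i < n)
  (pos_powR p (1 - i.+1%:R / n%:R) * pos_powR q (i%:R / n%:R)).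

Definition upper_beta_sum : R := n%:R^-1 * \sum_(i < n)
  (pos_powR p (1 - i%:R / n%:R) * pos_powR q (i.+1%:R / n%:R)).

Lemma pos_powR_ge0 r (l : R) : 0 <= pos_powR r l.
Proof. by rewrite /pos_powR; case: ifP => // _; exact: powR_ge0. Qed.

Lemma pos_powR_gt0 r (l : R) : 0 < l -> 0 < pos_powR r l.
Proof. by rewrite /pos_powR => l0; rewrite l0 powR_gt0. Qed.

End riemann_sums.

(** * Riemann sums *)

Section interval_integrals.
Context {R : realType}.
Local Notation mu := (@lebesgue_measure R).
Implicit Types (a b c t : R) (h : R -> R).

Lemma bounded_integrable_itv h a b (C : R) : measurable_fun `[a, b] h ->
  (forall s, a <= s <= b -> `|h s| <= C) ->
  mu.-integrable `[a, b] (EFin \o h).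
Proof.
move=> mh hC; apply: measurable_bounded_integrable => //.
  by rewrite /= lebesgue_measure_itv/=; case: ifP => // _; rewrite -EFinD ltry.
exists C; split; first exact: num_real.
move=> y Cy s /=; rewrite in_itv/= => sab.
by apply: le_trans (ltW Cy); exact: hC.
Qed.

Lemma Rintegral_itv_split h a b c : a <= b -> b <= c ->
  mu.-integrable `[a, c] (EFin \o h) ->
  \int[mu]_(s in `[a, c]) h s =
  \int[mu]_(s in `[a, b]) h s + \int[mu]_(s in `[b, c]) h s.
Proof.
move=> ab bc hi.
have := @Rintegral_itvB R h (BLeft a) (BRight c) b hi.
rewrite !bnd_simp => /(_ ab bc) /eqP; rewrite subr_eq addrC => /eqP ->.
congr (_ + _); apply: Rintegral_itv_obnd_cbnd.
apply: integrableS hi => //; apply: subset_itvr; rewrite bnd_simp; exact: ab.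
Qed.

Lemma Rintegral_itv_ge h a b (l : R) : a <= b ->
  mu.-integrable `[a, b] (EFin \o h) -> (forall s, a <= s <= b -> l <= h s) ->
  (b - a) * l <= \int[mu]_(s in `[a, b]) h s.
Proof.
move=> ab hi hl.
have -> : (b - a) * l = \int[mu]_(s in `[a, b]) (fun=> l) s.
  rewrite Rintegral_cst// /= lebesgue_measure_itv/= lte_fin mulrC.
  case: ltP => [_|ba]; first by rewrite -EFinD.
  by rewrite (@le_anti _ _ a b) ?ab// subrr.
apply: le_Rintegral => //.
apply: (@bounded_integrable_itv (fun=> l) a b `|l|) => //.
Qed.

Lemma Rintegral_itvN h a b : mu.-integrable `[a, b] (EFin \o h) ->
  \int[mu]_(s in `[a, b]) (- h s) = - \int[mu]_(s in `[a, b]) h s.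
Proof.
move=> hi; rewrite -mulN1r -RintegralZl//.
by apply: eq_Rintegral => s _; rewrite mulN1r.
Qed.

Lemma Rintegral_itv_le h a b (u : R) : a <= b ->
  mu.-integrable `[a, b] (EFin \o h) -> (forall s, a <= s <= b -> h s <= u) ->
  \int[mu]_(s in `[a, b]) h s <= (b - a) * u.
Proof.
move=> ab hi hu; rewrite -lerN2 -Rintegral_itvN// -mulrN.
apply: Rintegral_itv_ge => //; last by move=> s /hu; rewrite lerN2.
rewrite (_ : _ \o _ = (fun s => (-1)%:E * (EFin \o h) s)%E); last first.
  by apply/funext => s /=; rewrite -EFinM mulN1r.
exact: integrableZl.
Qed.

Lemma Rintegral_lower_sum h (t : R) (n : nat) (l : nat -> R) : 0 < t -> (0 < n)%N ->
  mu.-integrable `[0, t] (EFin \o h) ->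
  (forall i s, (i < n)%N -> i%:R / n%:R * t <= s <= i.+1%:R / n%:R * t ->
     l i <= h s) ->
  t / n%:R * \sum_(i < n) l i <= \int[mu]_(s in `[0, t]) h s.
Proof.
move=> t0 n0 hi hl; have n0' : 0 < n%:R :> R by rewrite ltr0n.
have E : t = n%:R / n%:R * t by rewrite divff ?mul1r// gt_eqF.
suff key m : (m <= n)%N -> t / n%:R * \sum_(i < m) l i <=
    \int[mu]_(s in `[0, m%:R / n%:R * t]) h s.
  by have := key n (leqnn n); rewrite -E.
elim: m => [|m IH] mn.
  rewrite big_ord0 mulr0 mul0r mul0r set_itv1.
  by rewrite Rintegral_set1.
have am i : 0 <= i%:R / n%:R * t.
  by rewrite mulr_ge0 ?(ltW t0)// divr_ge0.
have le_mn i j : (i <= j)%N -> i%:R / n%:R * t <= j%:R / n%:R * t.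
  by move=> ij; rewrite ler_pM2r// ler_pM2r ?invr_gt0// ler_nat.
have hS i j : (i <= j)%N -> (j <= n)%N ->
    mu.-integrable `[i%:R / n%:R * t, j%:R / n%:R * t] (EFin \o h).
  move=> ij jn; apply: integrableS hi => //; apply: subset_itv; rewrite bnd_simp//.
  by rewrite [leRHS]E le_mn.
rewrite (@Rintegral_itv_split h 0 (m%:R / n%:R * t))//; last 2 first.
- by rewrite le_mn.
- by have := hS 0%N m.+1; rewrite !mul0r; apply.
rewrite big_ord_recr/= mulrDr lerD//; first by apply: IH; exact: ltnW.
have := @Rintegral_itv_ge h (m%:R / n%:R * t) (m.+1%:R / n%:R * t) (l m).
rewrite (_ : _ - _ = t / n%:R); last by rewrite -natr1; field; rewrite gt_eqF.
apply; [exact: le_mn|exact: hS|by move=> s; exact: hl].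
Qed.

Lemma Rintegral_upper_sum h (t : R) (n : nat) (u : nat -> R) : 0 < t -> (0 < n)%N ->
  mu.-integrable `[0, t] (EFin \o h) ->
  (forall i s, (i < n)%N -> i%:R / n%:R * t <= s <= i.+1%:R / n%:R * t ->
     h s <= u i) ->
  \int[mu]_(s in `[0, t]) h s <= t / n%:R * \sum_(i < n) u i.
Proof.
move=> t0 n0 hi hu.
rewrite -lerN2 -Rintegral_itvN// -mulrN -sumrN.
apply: (@Rintegral_lower_sum _ t n (fun i => - u i)) => //.
  rewrite (_ : _ \o _ = (fun s => (-1)%:E * (EFin \o h) s)%E); last first.
    by apply/funext => s /=; rewrite -EFinM mulN1r.
  exact: integrableZl.
by move=> i s ni /(hu _ _ ni); rewrite lerN2.
Qed.

End interval_integrals.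

Section beta_sums.
Context {R : realType}.
Variables p q : R.
Hypotheses (p0 : 0 <= p) (q0 : 0 <= q).

Let J : R := fine (Beta_ext p q).

Let pos_powR_le r (a b : R) : 0 <= r -> a <= b -> 0 <= b ->
  pos_powR r a <= b `^ r.
Proof.
move=> r0 ab b0; rewrite /pos_powR; case: ifPn => [a0|_]; last exact: powR_ge0.
by apply: ge0_ler_powR; rewrite ?nnegrE// ltW.
Qed.

Let pos_powR_ge r (a b : R) : 0 <= r -> 0 <= a -> a <= b -> 0 < b ->
  a `^ r <= pos_powR r b.
Proof.
by move=> r0 a0 ab b0; rewrite /pos_powR b0; apply: ge0_ler_powR; rewrite ?nnegrE// ltW.
Qed.

Let pos_powR_mono r : 0 <= r -> {homo @pos_powR R r : a b / a <= b}.
Proof.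
move=> r0 a b ab; rewrite {1}/pos_powR; case: ifPn => [a0|_]; last exact: pos_powR_ge0.
by apply: pos_powR_ge => //; [exact: ltW|exact: lt_le_trans ab].
Qed.

Let beta_integrable :
  (@lebesgue_measure R).-integrable `[0, 1] (EFin \o beta_kernel p q).
Proof.
apply: continuous_compact_integrable; first exact: segment_compact.
exact: beta_kernel_within_continuous.
Qed.

Lemma lower_beta_sum_bound n : (0 < n)%N -> lower_beta_sum p q n <= J.
Proof.
move=> n0; have n0' : 0 < n%:R :> R by rewrite ltr0n.
rewrite /lower_beta_sum -[X in X * _]mul1r.
apply: (@Rintegral_lower_sum _ (beta_kernel p q) 1 n (fun i =>
  pos_powR p (1 - i.+1%:R / n%:R) * pos_powR q (i%:R / n%:R))) => //.
move=> i s ni; rewrite !mulr1 => /andP[ls sl].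
have s0 : 0 <= s by apply: le_trans ls; rewrite divr_ge0.
have s1 : s <= 1 by apply: (le_trans sl); rewrite ler_pdivrMr// mul1r ler_nat.
rewrite ler_pM ?pos_powR_ge0//; last exact: pos_powR_le.
by apply: pos_powR_le => //; [exact: lerB|rewrite subr_ge0].
Qed.

Lemma upper_beta_sum_bound n : (0 < n)%N -> J <= upper_beta_sum p q n.
Proof.
move=> n0; have n0' : 0 < n%:R :> R by rewrite ltr0n.
rewrite /upper_beta_sum -[X in X * _]mul1r.
apply: (@Rintegral_upper_sum _ (beta_kernel p q) 1 n (fun i =>
  pos_powR p (1 - i%:R / n%:R) * pos_powR q (i.+1%:R / n%:R))) => //.
move=> i s ni; rewrite !mulr1 => /andP[ls sl].
have s0 : 0 <= s by apply: le_trans ls; rewrite divr_ge0.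
have s1 : s <= 1 by apply: (le_trans sl); rewrite ler_pdivrMr// mul1r ler_nat.
rewrite ler_pM ?powR_ge0//; last first.
  by apply: pos_powR_ge => //; rewrite divr_gt0// ltr0n.
apply: pos_powR_ge => //; first by rewrite subr_ge0.
  exact: lerB.
by rewrite subr_gt0 ltr_pdivrMr// mul1r ltr_nat.
Qed.

(** The difference of corresponding terms is at most the sum of the increments of the two monotone
    factors, both with values in $[0, 1]$. These increments telescope to at most $1$ each. *)
Lemma beta_sum_gap n : (0 < n)%N ->
  upper_beta_sum p q n <= lower_beta_sum p q n + 2 / n%:R.
Proof.
move=> n0; have n0' : 0 < n%:R :> R by rewrite ltr0n.
pose a i := pos_powR p (1 - i%:R / n%:R : R).
pose b i := pos_powR q (i%:R / n%:R : R).
have le01 r (l : R) : 0 <= r -> l <= 1 -> 0 <= pos_powR r l <= 1.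
  move=> r0 l1; rewrite pos_powR_ge0/=; apply: (le_trans (pos_powR_mono r0 l1)).
  by rewrite /pos_powR ltr01 powR1.
have fr i : (i <= n)%N -> 0 <= (i%:R / n%:R : R) <= 1.
  by move=> ni; rewrite divr_ge0//= ler_pdivrMr// mul1r ler_nat.
have a01 i : (i <= n)%N -> 0 <= a i <= 1.
  by move=> /fr /andP[l0 _]; apply: le01 => //; rewrite gerBl.
have b01 i : (i <= n)%N -> 0 <= b i <= 1.
  by move=> /fr /andP[_ l1]; apply: le01.
have step i : (i < n)%N ->
    a i * b i.+1 <= a i.+1 * b i + ((a i - a i.+1) + (b i.+1 - b i)).
  move=> ni; have /andP[a0 a1] := a01 _ (ltnW ni).
  have /andP[a0' a1'] := a01 _ ni.
  have /andP[b0 b1] := b01 _ (ltnW ni).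
  have /andP[b0' b1'] := b01 _ ni.
  have da : a i.+1 <= a i.
    by apply: pos_powR_mono => //; rewrite lerB// ler_pM2r ?invr_gt0// ler_nat.
  have db : b i <= b i.+1.
    by apply: pos_powR_mono => //; rewrite ler_pM2r ?invr_gt0// ler_nat.
  have h1 : (a i - a i.+1) * b i.+1 <= a i - a i.+1.
    by rewrite ler_piMr// subr_ge0.
  have h2 : a i.+1 * (b i.+1 - b i) <= b i.+1 - b i.
    by rewrite ler_piMl// subr_ge0.
  lra.
rewrite /upper_beta_sum /lower_beta_sum -/a -/b [2 / _]mulrC -mulrDr ler_pM2l ?invr_gt0//.
apply: (@le_trans _ _ (\sum_(i < n) (a i.+1 * b i + ((a i - a i.+1) + (b i.+1 - b i))))).
  by apply: ler_sum => i _; exact: step.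
rewrite big_split/= lerD2l big_split/=.
have ta : \sum_(i < n) (a i - a i.+1) = a 0%N - a n.
  rewrite -(big_mkord xpredT (fun i => a i - a i.+1)) -[RHS]opprB -telescope_sumr//.
  by rewrite -sumrN; apply: eq_bigr => i _; rewrite opprB.
have tb : \sum_(i < n) (b i.+1 - b i) = b n - b 0%N.
  by rewrite -(big_mkord xpredT (fun i => b i.+1 - b i)) telescope_sumr.
rewrite ta tb.
have /andP[? ?] := a01 _ (leqnn n); have /andP[? ?] := a01 _ (leq0n n).
have /andP[? ?] := b01 _ (leqnn n); have /andP[? ?] := b01 _ (leq0n n).
lra.
Qed.

Lemma beta_gt0 : 0 < J.
Proof.
(* Three is the least number of cells for which the lower sum has a nonzero term, the middle one. *)
apply: lt_le_trans (lower_beta_sum_bound (n := 3) isT).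
rewrite /lower_beta_sum mulr_gt0 ?invr_gt0//.
rewrite !big_ord_recr/= big_ord0 add0r.
rewrite ltr_wpDr ?mulr_ge0 ?pos_powR_ge0// ltr_wpDl ?mulr_ge0 ?pos_powR_ge0//.
by rewrite mulr_gt0 ?pos_powR_gt0//; lra.
Qed.

End beta_sums.

(** * The ratio x / (t M(t) f(x)) *)

Section volterra.
Context {R : realType}.
Variables (M f x : R -> R) (theta beta xi : R).
Hypothesis theta0 : 0 <= theta.
Hypothesis beta01 : 0 <= beta < 1.
Hypothesis xi0 : 0 < xi.
Hypothesis M0 : forall t, 0 <= M t.
Hypothesis Mnd : {homo M : s t / s <= t}.
Hypothesis Mpos : \forall t \near +oo, 0 < M t.
Hypothesis Mindex : has_index theta M.
Hypothesis fc : pos_continuous f.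
Hypothesis findex : has_index beta f.
Hypothesis fq : quasi_increasing f.
Hypothesis foo : f u @[u --> +oo] --> +oo.
Hypothesis xxi : forall t, 0 <= t -> xi <= x t.
Hypothesis xnd : forall s t, 0 <= s -> s <= t -> x s <= x t.
Hypothesis xoo : x t @[t --> +oo] --> +oo.
(** Apart from the monotonicity and growth of [x], the integral equation enters only through this
    bound and the next, by step functions below and above the integrand. *)
Hypothesis xlow : forall (t : R) (n : nat) (l : nat -> R), 0 < t -> (0 < n)%N ->
  (forall i s, (i < n)%N -> i%:R / n%:R * t <= s <= i.+1%:R / n%:R * t ->
     l i <= M (t - s) * f (x s)) ->
  t / n%:R * \sum_(i < n) l i <= x t.
Hypothesis xupp : forall (t : R) (n : nat) (u : nat -> R), 0 < t -> (0 < n)%N ->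
  (forall i s, (i < n)%N -> i%:R / n%:R * t <= s <= i.+1%:R / n%:R * t ->
     M (t - s) * f (x s) <= u i) ->
  x t <= xi + t / n%:R * \sum_(i < n) u i.

Let sigma := 1 - beta.
Let gamma := (1 + theta) / sigma.
Let g (u : R) := u / f u.
Let q (t : R) := g (x t) / (t * M t).

Let sigma0 : 0 < sigma.
Proof. by rewrite subr_gt0; case/andP: beta01. Qed.

Let x_gt0 t : 0 <= t -> 0 < x t.
Proof. by move=> t0; apply: lt_le_trans (xxi t0). Qed.

(** Scaling time by [l] should scale [x] by $l^\gamma$. Then [g (x t)] scales like [t * M t], and
    [f (x t)] by the power in the Beta kernel. *)
Let powE (l : R) : 0 < l ->
  ((l `^ gamma) `^ sigma = l * l `^ theta) * ((l `^ gamma) `^ beta = l `^ (gamma * beta)).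
Proof.
move=> l0; rewrite -!powRrM divfK ?gt_eqF//; split => //.
by rewrite powRD ?(gt_eqF l0) ?implybT// powRr1// ltW.
Qed.

(** As [M] may jump, [q] need not be continuous. It is bounded factor by factor: the numerator by
    the extreme value theorem for [g] on [[x T0, x T]], the denominator by monotonicity. *)
Let ratio_bounds T0 T : 0 < T0 -> 0 < M T0 ->
  exists m C : R, [/\ 0 < m, 0 < C & forall s, T0 <= s <= T -> m <= q s <= C].
Proof.
move=> T00 MT0.
have [TT0|T0T] := ltP T T0.
  exists 1, 1; split => // s /andP[/le_trans/[apply]].
  by rewrite leNgt TT0.
have T0' : 0 < T by apply: lt_le_trans T0T.
have MT : 0 < M T by apply: lt_le_trans (Mnd T0T).
have xT0 : 0 < x T0 by apply/x_gt0/ltW.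
have xT : x T0 <= x T by apply: xnd => //; exact: ltW.
have gc := pos_continuous_within (b := x T) (ratio_pos_continuous fc) xT0.
have [c1 c1I c1m] := EVT_min xT gc.
have [c2 c2I c2m] := EVT_max xT gc.
have g0 c : c \in `[x T0, x T] -> 0 < g c.
  rewrite in_itv/= => /andP[xc _]; apply: (ratio_pos_continuous fc).2.
  exact: lt_le_trans xc.
exists (g c1 / (T * M T)), (g c2 / (T0 * M T0)); split.
- by apply: divr_gt0; [exact: g0|exact: mulr_gt0].
- by apply: divr_gt0; [exact: g0|exact: mulr_gt0].
move=> s /andP[T0s sT].
have s0 : 0 < s by apply: lt_le_trans T0s.
have Ms : 0 < M s by apply: lt_le_trans (Mnd T0s).
have xs : x s \in `[x T0, x T] by rewrite in_itv/= !xnd// ltW.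
have sM0 : 0 < s * M s by rewrite mulr_gt0.
apply/andP; split; apply: ler_pM.
- exact/ltW/g0.
- by rewrite invr_ge0 mulr_ge0// ltW.
- exact: c1m.
- by rewrite lef_pV2 ?posrE ?mulr_gt0// ler_pM ?Mnd// ltW.
- exact/ltW/g0.
- by rewrite invr_ge0 ltW.
- exact: c2m.
- by rewrite lef_pV2 ?posrE ?mulr_gt0// ler_pM ?Mnd// ltW.
Qed.

Let q_gt0 t : 0 < t -> 0 < M t -> 0 < q t.
Proof.
move=> t0 Mt; apply: divr_gt0; last exact: mulr_gt0.
by apply: (ratio_pos_continuous fc).2; apply/x_gt0/ltW.
Qed.

Let gE t : 0 < t -> 0 < M t -> g (x t) = q t * (t * M t).
Proof. by move=> t0 Mt; rewrite /q divfK// gt_eqF// mulr_gt0. Qed.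

(** Of the four factors [d], two pay for [compare_lower], one for the index of [M], and the last
    absorbs the tolerance [r] of the almost minimum. With [n] fixed, finitely many eventual
    conditions suffice. *)
Lemma lower_beta_sum_le d n : 0 < d < 1 -> (0 < n)%N ->
  \forall t \near +oo, d ^+ 4 * lower_beta_sum theta (gamma * beta) n <= q t.
Proof.
move=> d01 n0; have [d0 d1] := andP d01.
set LS := lower_beta_sum _ _ _.
have n0' : 0 < n%:R :> R by rewrite ltr0n.
have [T0 T00 MT0] := (near_pinftyP _).1 Mpos.
(* The sum vanishes for [n] at most $2$; otherwise the level $d^4 LS$ is positive, as
   [almost_running_min] requires. *)
have [LS0|LS0] := leP LS 0.
  near=> t; have tT0 : T0 <= t by near: t; exact: near_pinfty_ge.
  apply: (@le_trans _ _ 0); last first.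
    by rewrite ltW// q_gt0// ?MT0// (lt_le_trans T00).
  by rewrite mulr_ge0_le0// exprn_ge0// ltW.
apply: contrapT => /not_near_pinfty qv.
have {}qv T : exists2 t, T <= t & q t < d ^+ 4 * LS.
  by have [t tT /negP] := qv T; rewrite -ltNge; exists t.
have [k k1 cmp] := compare_lower beta01 fc findex fq d01.
have [r [r1 rk rd]] := small_factor d01 k1.
have r0 : 0 < r by apply: lt_trans r1.
have qlb T : exists2 m : R, 0 < m & forall s, T0 <= s <= T -> m <= q s.
  have [m [C [m0 _ mq]]] := ratio_bounds T T00 (MT0 _ (lexx _)).
  by exists m => // s /mq /andP[].
have v0 : 0 < d ^+ 4 * LS by rewrite mulr_gt0// exprn_gt0.
have [S T0S qS] := almost_running_min qlb r1 v0 qv.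
have S0 : 0 < S by apply: lt_le_trans T0S.
pose lam i : R := i%:R / n%:R.
have lam0 i : (0 < i)%N -> 0 < lam i by move=> i0; rewrite divr_gt0// ltr0n.
have near_i i : (i < n)%N -> \forall t \near +oo, (0 < i)%N ->
    [/\ S <= lam i * t, lam i `^ theta / r * M t < M (lam i * t) &
      forall s, lam i * t <= s -> s <= t ->
      (lam i `^ gamma) `^ sigma * g (x t) <= k * g (x s) ->
      d ^+ 2 * (lam i `^ gamma) `^ beta * f (x t) <= f (x s)].
  move=> ni; case: (posnP i) => [->|i0]; first by apply: nearW.
  have li0 := lam0 _ i0.
  have [X X0 cX] := cmp _ (powR_gt0 gamma li0).
  have hM : \forall t \near +oo, lam i `^ theta / r * M t < M (lam i * t).
    apply: (has_index_gt Mpos Mindex li0).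
    by rewrite ltr_pdivrMr// ltr_pMr// powR_gt0.
  have [Y Y0 xY] := (near_pinftyP _).1 (proj1 (cvgryPge _) xoo X).
  near=> t; move=> _.
  have St : S / lam i <= t by near: t; exact: near_pinfty_ge.
  have Yt : Y / lam i <= t by near: t; exact: near_pinfty_ge.
  split.
  - by rewrite mulrC -ler_pdivrMr.
  - by near: t.
  - move=> s ls st; have Ys : Y <= s.
      by apply: le_trans ls; rewrite mulrC -ler_pdivrMr.
    by apply: cX; apply: xY => //; exact: le_trans st.
have near_u i : (i < n)%N -> \forall t \near +oo,
    d * pos_powR theta (1 - lam i.+1) * M t <= M ((1 - lam i.+1) * t).
  move=> ni; rewrite /pos_powR; case: ifPn => [l0|_]; last first.
    by apply: nearW => t; rewrite mulr0 mul0r.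
  have : d * (1 - lam i.+1) `^ theta < (1 - lam i.+1) `^ theta.
    by rewrite gtr_pMl// powR_gt0.
  by move=> /(has_index_gt Mpos Mindex l0); apply: filterS => t /ltW.
have [T1 T10 hT1] := (near_pinftyP _).1
  (filterI (near_forall_ltn near_i) (near_forall_ltn near_u)).
(* All grid thresholds are gathered in [T1] before the almost minimal time is chosen beyond it. *)
have [t [T1t St qt qs]] := qS T1.
have {hT1} [hi hu] := hT1 t T1t.
have t0 : 0 < t by apply: lt_le_trans St.
have Mt : 0 < M t by apply: MT0; apply: le_trans St.
have fxt : 0 < f (x t) by apply: fc.2; apply/x_gt0/ltW.
pose l i := d ^+ 3 * (pos_powR theta (1 - lam i.+1) * pos_powR (gamma * beta) (lam i))
  * (M t * f (x t)).
have /(xlow t0 n0) : forall i s, (i < n)%N -> lam i * t <= s <= lam i.+1 * t ->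
    l i <= M (t - s) * f (x s).
  move=> i s ni /andP[ls sl].
  have lt0 : 0 <= lam i * t by rewrite mulr_ge0 ?(ltW t0)// divr_ge0.
  have s0 : 0 <= s by apply: le_trans ls.
  have st : s <= t.
    by apply: (le_trans sl); rewrite ler_piMl ?(ltW t0)// ler_pdivrMr// mul1r ler_nat.
  have fxs := fc.2 _ (x_gt0 s0).
  (* On the first cell [s] may be small and no comparison is available, but there the bound [l i] is
     zero. *)
  case: (posnP i) => [i0|i0].
    rewrite /l i0 /lam mul0r {2}/pos_powR ltxx mulr0 mulr0 mul0r.
    by rewrite mulr_ge0// ltW.
  have [Sl lM cs] := hi i ni i0.
  have Ss : S <= s by apply: le_trans ls.
  have s0' : 0 < s by apply: lt_le_trans Ss.
  have Ms : 0 < M s by apply: MT0; apply: le_trans Ss.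
  have li0 := lam0 _ i0.
  have h1 : d * pos_powR theta (1 - lam i.+1) * M t <= M (t - s).
    apply: (le_trans (hu i ni)); apply: Mnd.
    by rewrite mulrBl mul1r lerB.
  have h2 : d ^+ 2 * pos_powR (gamma * beta) (lam i) * f (x t) <= f (x s).
    rewrite /pos_powR li0 -(powE li0).2; apply: cs => //.
    rewrite (powE li0).1 !gE//.
    have qts : q t <= r * q s by apply: qs; rewrite Ss st.
    (* One factor [r] is lost here and another in [qts]; together they fit into [k], which is the
       premise of the comparison. *)
    have lsM : lam i * t * (lam i `^ theta * M t) <= s * (r * M s).
      apply: ler_pM => //; first by rewrite mulr_ge0 ?powR_ge0.
      rewrite -ler_pdivrMl// mulrA [r^-1 * _]mulrC (le_trans (ltW lM))//.
      exact: Mnd.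
    rewrite (_ : _ * _ = q t * (lam i * t * (lam i `^ theta * M t))); last by ring.
    apply: (@le_trans _ _ (r * q s * (s * (r * M s)))).
      apply: ler_pM => //; first by rewrite ltW// q_gt0.
      by rewrite !mulr_ge0 ?powR_ge0// ltW.
    rewrite (_ : r * _ * _ = r ^+ 2 * (q s * (s * M s))); last by ring.
    by rewrite ler_pM2r//; apply: mulr_gt0; [exact: q_gt0|exact: mulr_gt0].
  rewrite /l (_ : _ * _ = (d * pos_powR theta (1 - lam i.+1) * M t) *
    (d ^+ 2 * pos_powR (gamma * beta) (lam i) * f (x t))); last by ring.
  by apply: ler_pM => //; rewrite !mulr_ge0 ?pos_powR_ge0 ?exprn_ge0// ltW.
have -> : t / n%:R * \sum_(i < n) l i = d ^+ 3 * LS * (t * M t * f (x t)).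
  rewrite /l -mulr_suml -mulr_sumr /LS /lower_beta_sum; field.
  by rewrite gt_eqF.
rewrite -ler_pdivlMr ?mulr_gt0//.
have -> : x t / (t * M t * f (x t)) = q t by rewrite /q /g; field; rewrite !gt_eqF.
move=> /le_trans /(_ qt); apply/negP; rewrite -ltNge.
rewrite (_ : r * _ = (r * d) * (d ^+ 3 * LS)); last by ring.
by rewrite gtr_pMl// mulr_gt0// exprn_gt0.
Unshelve. all: by end_near. Qed.

(** The argument runs on almost minima of $1/q$. Three factors [d] pay for the comparisons of [f]
    and [M], one absorbs [r], and the other two leave room for the constant [xi]. *)
Lemma upper_beta_sum_ge d n : 0 < d < 1 -> (0 < n)%N ->
  \forall t \near +oo, d ^+ 6 * q t <= upper_beta_sum theta (gamma * beta) n.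
Proof.
move=> d01 n0; have [d0 d1] := andP d01.
set US := upper_beta_sum _ _ _.
have n0' : 0 < n%:R :> R by rewrite ltr0n.
have [T0 T00 MT0] := (near_pinftyP _).1 Mpos.
pose lam i : R := i%:R / n%:R.
have lam0 i : 0 < lam i.+1 by rewrite divr_gt0// ltr0n.
have lam1 i : (i < n)%N -> 0 < 1 - lam i.
  by move=> ni; rewrite subr_gt0 ltr_pdivrMr// mul1r ltr_nat.
have US0 : 0 < US.
  rewrite mulr_gt0 ?invr_gt0// (bigD1 (Ordinal n0))//= ltr_pwDl//.
    by rewrite mulr_gt0 ?pos_powR_gt0 ?lam1 ?lam0.
  by apply: sumr_ge0 => i _; rewrite mulr_ge0 ?pos_powR_ge0.
apply: contrapT => /not_near_pinfty qv.
pose p t := (q t)^-1.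
have {}qv T : exists2 t, T <= t & p t < d ^+ 6 / US.
  have [t tT /negP] := qv (Num.max T T0).
  move: tT; rewrite ge_max => /andP[Tt T0t]; rewrite -ltNge => qt; exists t => //.
  have qt0 : 0 < q t by rewrite q_gt0 ?MT0// (lt_le_trans T00).
  by rewrite /p ltr_pdivlMr// mulrC ltr_pdivrMr.
have [k k1 cmp] := compare_upper beta01 fc findex fq d01.
have [r [r1 rk rd]] := small_factor d01 k1.
have r0 : 0 < r by apply: lt_trans r1.
have plb T : exists2 m : R, 0 < m & forall s, T0 <= s <= T -> m <= p s.
  have [m [C [m0 C0 mq]]] := ratio_bounds T T00 (MT0 _ (lexx _)).
  exists C^-1; first by rewrite invr_gt0.
  move=> s /mq /andP[ms sC].
  by rewrite lef_pV2// posrE (lt_le_trans m0).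
have v0 : 0 < d ^+ 6 / US by rewrite divr_gt0// exprn_gt0.
have [S T0S pS] := almost_running_min plb r1 v0 qv.
have S0 : 0 < S by apply: lt_le_trans T0S.
have [X X0 cX] : exists2 X, 0 < X & forall i, (i < n)%N ->
    forall a b, X <= a -> X <= b ->
    g a <= k * (lam i.+1 `^ gamma) `^ sigma * g b ->
    d ^+ 2 * f a <= (lam i.+1 `^ gamma) `^ beta * f b.
  have : forall i, (i < n)%N -> \forall X \near +oo, forall a b, X <= a -> X <= b ->
    g a <= k * (lam i.+1 `^ gamma) `^ sigma * g b ->
    d ^+ 2 * f a <= (lam i.+1 `^ gamma) `^ beta * f b.
    move=> i _; have [X X0 cX] := cmp _ (powR_gt0 gamma (lam0 i)).
    by near=> Y; move=> a b Ya Yb; apply: cX;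
      [apply: le_trans Ya|apply: le_trans Yb]; near: Y; exact: near_pinfty_ge.
  move=> /near_forall_ltn/near_pinftyP[X X0 cX].
  by exists X => // i ni; exact: (cX X (lexx _)).
have [Y Y0 xY] := (near_pinftyP _).1 (proj1 (cvgryPge _) xoo X).
pose Z := Num.max S Y.
have Z0 : 0 < Z by rewrite lt_max S0.
have [C fC] : exists C, forall s, 0 <= s <= Z -> d ^+ 2 * f (x s) <= C.
  have [c _ cm] := EVT_max (xxi (ltW Z0)) (pos_continuous_within (b := x Z) fc xi0).
  exists (d ^+ 2 * f c) => s /andP[s0 sZ]; rewrite ler_pM2l ?exprn_gt0//.
  by apply: cm; rewrite in_itv/= xxi//= xnd.
have near_i i : (i < n)%N -> \forall t \near +oo,
    [/\ C <= pos_powR (gamma * beta) (lam i.+1) * f (x t),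
        M (lam i.+1 * t) <= r * lam i.+1 `^ theta * M t &
        d * M ((1 - lam i) * t) <= pos_powR theta (1 - lam i) * M t].
  move=> ni.
  have h1 : \forall t \near +oo, C / pos_powR (gamma * beta) (lam i.+1) <= f (x t).
    exact: (proj1 (cvgryPge _) (cvg_comp _ _ xoo foo)).
  have h2 : \forall t \near +oo, M (lam i.+1 * t) < r * lam i.+1 `^ theta * M t.
    by apply: (has_index_lt Mpos Mindex) => //; rewrite ltr_pMl// powR_gt0.
  have h3 : \forall t \near +oo, M ((1 - lam i) * t) < (1 - lam i) `^ theta / d * M t.
    apply: (has_index_lt Mpos Mindex (lam1 _ ni)).
    by rewrite ltr_pdivlMr// gtr_pMr// powR_gt0// lam1.
  near=> t; split.
  - by rewrite mulrC -ler_pdivrMr ?pos_powR_gt0//; near: t.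
  - by rewrite ltW//; near: t.
  - rewrite /pos_powR lam1// -ler_pdivlMl// mulrA [d^-1 * _]mulrC.
    by rewrite ltW//; near: t.
have d'0 : 0 < 1 - d by rewrite subr_gt0.
(* This makes [xi] at most $(1 - d) US$ times [t * M t * f (x t)], because [t * M t] is at least
   [T0 * M T0]. *)
have near_xi : \forall t \near +oo,
    xi / ((1 - d) * US * (T0 * M T0)) <= f (x t).
  exact: (proj1 (cvgryPge _) (cvg_comp _ _ xoo foo)).
have [T1 T10 hT1] := (near_pinftyP _).1 (filterI near_xi (near_forall_ltn near_i)).
have [t [tm St pt ps]] := pS (Num.max T1 Z).
have /andP[T1t Zt] : (T1 <= t) && (Z <= t) by rewrite -ge_max.
have {hT1} [hxi hi] := hT1 t T1t.
have t0 : 0 < t by apply: lt_le_trans St.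
have T0t : T0 <= t by apply: le_trans St.
have Mt : 0 < M t by apply: MT0.
have fxt : 0 < f (x t) by apply: fc.2; apply/x_gt0/ltW.
have qt0 := q_gt0 t0 Mt.
pose W := t * M t * f (x t).
have W0 : 0 < W by rewrite !mulr_gt0.
have xiW : xi <= (1 - d) * US * W.
  have MT00 := MT0 _ (lexx T0).
  have dU0 := mulr_gt0 d'0 US0.
  move: hxi; rewrite ler_pdivrMr; last exact: mulr_gt0 dU0 (mulr_gt0 T00 MT00).
  move=> /le_trans; apply.
  rewrite [leLHS](_ : _ = (1 - d) * US * (T0 * M T0 * f (x t))); last by ring.
  rewrite (ler_pM2l dU0) /W (ler_pM2r fxt).
  by apply: ler_pM => //; [exact: ltW|exact: Mnd].
pose u i := d ^- 3 * (pos_powR theta (1 - lam i) * pos_powR (gamma * beta) (lam i.+1))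
  * (M t * f (x t)).
have /(xupp t0 n0) : forall i s, (i < n)%N -> lam i * t <= s <= lam i.+1 * t ->
    M (t - s) * f (x s) <= u i.
  move=> i s ni /andP[ls sl].
  have lt0 : 0 <= lam i * t by rewrite mulr_ge0 ?(ltW t0)// divr_ge0.
  have s0 : 0 <= s by apply: le_trans ls.
  have st : s <= t.
    by apply: (le_trans sl); rewrite ler_piMl ?(ltW t0)// ler_pdivrMr// mul1r ler_nat.
  have fxs := fc.2 _ (x_gt0 s0).
  have [hC hM hu] := hi i ni.
  have h1 : d * M (t - s) <= pos_powR theta (1 - lam i) * M t.
    apply: le_trans hu; rewrite ler_pM2l//; apply: Mnd.
    by rewrite mulrBl mul1r lerB.
  have h2 : d ^+ 2 * f (x s) <= pos_powR (gamma * beta) (lam i.+1) * f (x t).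
    have [sZ|Zs] := leP s Z.
      by apply: le_trans hC; apply: fC; rewrite s0.
    have Ss : S <= s by apply: le_trans (ltW Zs); rewrite le_max lexx.
    have Ys : Y <= s by apply: le_trans (ltW Zs); rewrite le_max lexx orbT.
    have s0' : 0 < s by apply: lt_le_trans Ss.
    have Ms : 0 < M s by apply: MT0; apply: le_trans Ss.
    rewrite /pos_powR lam0 -(powE (lam0 i)).2; apply: cX => //.
    - exact: xY.
    - by apply: xY; apply: le_trans st.
    rewrite (powE (lam0 i)).1 !gE//.
    have qts : q s <= r * q t.
      have := ps s; rewrite Ss st => /(_ isT); rewrite /p.
      by rewrite ler_pdivlMr ?q_gt0// mulrC ler_pdivrMr.
    have lsM : s * M s <= lam i.+1 * t * (r * lam i.+1 `^ theta * M t).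
      apply: ler_pM => //; apply: le_trans hM; exact: Mnd.
    have lM0 : 0 <= lam i.+1 * t * (lam i.+1 `^ theta * M t).
      by rewrite !mulr_ge0 ?powR_ge0// ltW.
    apply: (@le_trans _ _ (r * q t * (lam i.+1 * t * (r * lam i.+1 `^ theta * M t)))).
      apply: ler_pM => //; first by rewrite ltW// q_gt0.
      by rewrite mulr_ge0 ?(ltW s0').
    rewrite [leLHS](_ : _ = r ^+ 2 * (q t * (lam i.+1 * t * (lam i.+1 `^ theta * M t)))); last by ring.
    rewrite [leRHS](_ : _ = k * (q t * (lam i.+1 * t * (lam i.+1 `^ theta * M t)))); last by ring.
    by rewrite ler_wpM2r// mulr_ge0// ltW.
  rewrite /u -mulrA ler_pdivlMl ?exprn_gt0//.
  rewrite [leLHS](_ : _ = (d * M (t - s)) * (d ^+ 2 * f (x s))); last by ring.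
  rewrite [leRHS](_ : _ = (pos_powR theta (1 - lam i) * M t) *
    (pos_powR (gamma * beta) (lam i.+1) * f (x t))); last by ring.
  by apply: ler_pM => //; rewrite !mulr_ge0 ?exprn_ge0// ltW.
have -> : t / n%:R * \sum_(i < n) u i = d ^- 3 * US * W.
  rewrite /u -mulr_suml -mulr_sumr /US /upper_beta_sum /W; field.
  by rewrite !gt_eqF.
have -> : x t = q t * W by rewrite /q /g /W; field; rewrite !gt_eqF.
have USq : US < d ^+ 5 * q t.
  have : US <= r * d ^+ 6 * q t.
    by move: pt; rewrite /p mulrA ler_pdivlMr// mulrC ler_pdivrMr.
  move=> /le_lt_trans; apply; rewrite [ltLHS](_ : _ = r * d * (d ^+ 5 * q t)); last by ring.
  by rewrite gtr_pMl// mulr_gt0// exprn_gt0.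
(* After division by [W], the bound on [q t] is $(1 - d) US + d^{-3} US$, which is less than $(1 -
   d) q + d^2 q \le q$. *)
move=> qW; have {qW} := le_trans qW (lerD xiW (lexx _)).
rewrite -mulrDl ler_pM2r// leNgt => /negP; apply.
have h1 : d ^- 3 * US < d ^+ 2 * q t.
  by rewrite mulrC ltr_pdivrMr ?exprn_gt0// [ltRHS](_ : _ = d ^+ 5 * q t)//; ring.
have h2 : US < q t.
  by apply: (lt_le_trans USq); rewrite ler_piMl ?(ltW qt0)// exprn_ile1// ltW.
have h3 : (1 - d) * US < (1 - d) * q t by rewrite ltr_pM2l.
have h4 : d ^+ 2 * q t <= d * q t.
  by rewrite ler_pM2r// expr2 ler_piMl// ltW.
move: h1 h3 h4; set Q := q t; lra.
Unshelve. all: by end_near. Qed.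


Let J : R := fine (Beta_ext theta (gamma * beta)).

Let gb0 : 0 <= gamma * beta.
Proof.
rewrite mulr_ge0//; last by case/andP: beta01.
by rewrite divr_ge0// ?(ltW sigma0)// addr_ge0.
Qed.

(** A grid with $2/n \le (1 - d) J$ replaces the sums by [J]. Below, $d^3 J \le d J$ is under the
    lower sum; above, one more [d] suffices since $d(2 - d) = 1 - (1 - d)^2 \le 1$. Both losses fit
    into $d^7$. *)
Lemma ratio_cvg : q t @[t --> +oo] --> J.
Proof.
have J0 : 0 < J by exact: beta_gt0.
have gap d : 0 < d < 1 -> exists2 n, (0 < n)%N & 2 / n%:R <= (1 - d) * J :> R.
  move=> /andP[d0 d1]; have dJ : 0 < (1 - d) * J by rewrite mulr_gt0// subr_gt0.
  exists (Num.truncn (2 / ((1 - d) * J))).+1 => //.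
  by rewrite ler_pdivrMr ?ltr0n// mulrC -ler_pdivrMr//; apply/ltW/truncnS_gt.
apply: (@cvg_factor_squeeze _ _ _ 7) => // d d01; have [d0 d1] := andP d01;
  have [n n0 hn] := gap d d01; have := beta_sum_gap theta0 gb0 n0;
  have := lower_beta_sum_bound theta0 gb0 n0;
  have := upper_beta_sum_bound theta0 gb0 n0; rewrite -/J => JU LJ UL.
- apply: filterS (lower_beta_sum_le d01 n0) => t; apply: le_trans.
  rewrite (exprD d 4 3) -mulrA ler_pM2l ?exprn_gt0//.
  apply: (@le_trans _ _ (d * J)); last by lra.
  by rewrite ler_pM2r// exprS ler_piMr ?(ltW d0)// exprn_ile1// ltW.
- apply: filterS (upper_beta_sum_ge d01 n0) => t h.
  rewrite exprS -mulrA; apply: (le_trans (ler_wpM2l (ltW d0) h)).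
  have : upper_beta_sum theta (gamma * beta) n <= (2 - d) * J by lra.
  move=> /(ler_wpM2l (ltW d0)) /le_trans; apply.
  rewrite mulrA ler_piMl ?(ltW J0)//.
  by have := sqr_ge0 (1 - d); nra.
Qed.

(** The limit of [q] and the index of [M] give the limit of [g (x (l * t)) / g (x t)]. The
    comparison lemmas with $e = l^\gamma$ turn it into bounds on the ratio of [f], and $x = g(x)
    f(x)$ multiplies the two: a factor [d] for [g] and $d^2$ for [f]. *)
Lemma x_has_index : has_index gamma x.
Proof.
move=> l l0.
have e0 : 0 < l `^ gamma by exact: powR_gt0.
have es : (l `^ gamma) `^ sigma = l * l `^ theta := (powE l0).1.
have eb : l `^ gamma = (l `^ gamma) `^ sigma * (l `^ gamma) `^ beta.
  rewrite -powRD ?(gt_eqF e0) ?implybT// /sigma subrK powRr1// ltW//.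
have J0 : 0 < J by exact: beta_gt0.
have [T0 T00 MT0] := (near_pinftyP _).1 Mpos.
have glim : g (x (l * t)) / g (x t) @[t --> +oo] --> (l `^ gamma) `^ sigma.
  rewrite es.
  have c1 : q (l * t) @[t --> +oo] --> J.
    by apply: (cvg_comp _ _ _ ratio_cvg); exact: gt0_cvgMry.
  have : q (l * t) / q t * (l * (M (l * t) / M t)) @[t --> +oo] -->
      J / J * (l * l `^ theta).
    apply: cvgM; last by apply: cvgMl_tmp; exact: Mindex.
    by apply: cvgM => //; apply: cvgV ratio_cvg; rewrite gt_eqF.
  rewrite divff ?gt_eqF// mul1r.
  apply: cvg_trans; apply: near_eq_cvg; near=> t.
  have tT : T0 <= t by near: t; exact: near_pinfty_ge.
  have tT' : T0 / l <= t by near: t; exact: near_pinfty_ge.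
  have t0 : 0 < t by apply: lt_le_trans tT.
  have Mt : 0 < M t by exact: MT0.
  have lt0 : 0 < l * t by exact: mulr_gt0.
  have Ml : 0 < M (l * t) by apply: MT0; rewrite mulrC -ler_pdivrMr.
  rewrite (gE lt0 Ml) (gE t0 Mt).
  have := q_gt0 t0 Mt; move: (q t) (q (l * t)) => a b a0.
  by field; rewrite !gt_eqF.
have base d : 0 < d < 1 ->
  \forall t \near +oo, d ^+ 3 * l `^ gamma <= x (l * t) / x t /\
                       d ^+ 3 * (x (l * t) / x t) <= l `^ gamma.
  move=> d01; have [d0 d1] := andP d01.
  have [k1 k11 cl] := compare_lower beta01 fc findex fq d01.
  have [k2 k21 cu] := compare_upper beta01 fc findex fq d01.
  have [X1 X10 hl] := cl _ e0.
  have [X2 X20 hu] := cu _ e0.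
  have k0 : 1 < Num.min k1 k2 by rewrite lt_min k11.
  have [r [r1 rk rd]] := small_factor d01 k0.
  have r0 : 0 < r by apply: lt_trans r1.
  have rr : r <= r ^+ 2 by rewrite expr2 ler_peMl// ltW.
  have [rk1 rk2] : r <= k1 /\ r <= k2.
    by split; apply: (le_trans rr); apply: (le_trans rk); rewrite ge_min lexx ?orbT.
  have es0 : 0 < (l `^ gamma) `^ sigma by exact: powR_gt0.
  have n1 : \forall t \near +oo, (l `^ gamma) `^ sigma / r < g (x (l * t)) / g (x t).
    by apply: (cvgr_gt _ glim); rewrite ltr_pdivrMr// ltr_pMr.
  have n2 : \forall t \near +oo, g (x (l * t)) / g (x t) < r * (l `^ gamma) `^ sigma.
    by apply: (cvgr_lt _ glim); rewrite ltr_pMl.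
  have [Y Y0 xY] := (near_pinftyP _).1 (proj1 (cvgryPge _) xoo (X1 + X2)).
  near=> t.
  have tY : Y <= t by near: t; exact: near_pinfty_ge.
  have tY' : Y / l <= t by near: t; exact: near_pinfty_ge.
  have t0 : 0 < t by apply: lt_le_trans tY.
  have lt0 : 0 < l * t by exact: mulr_gt0.
  have xt0 := x_gt0 (ltW t0); have xl0 := x_gt0 (ltW lt0).
  have ft0 := fc.2 _ xt0; have fl0 := fc.2 _ xl0.
  have gt0' : 0 < g (x t) by exact: divr_gt0.
  have gl0 : 0 < g (x (l * t)) by exact: divr_gt0.
  have xE u : 0 < u -> u = g u * f u by move=> u0; rewrite /g divfK// gt_eqF// fc.2.
  have Xt : X1 + X2 <= x t by exact: xY.
  have Xl : X1 + X2 <= x (l * t) by apply: xY; rewrite mulrC -ler_pdivrMr.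
  have h1 : (l `^ gamma) `^ sigma / r < g (x (l * t)) / g (x t) by near: t.
  have h2 : g (x (l * t)) / g (x t) < r * (l `^ gamma) `^ sigma by near: t.
  move: h1; rewrite ltr_pdivlMr// mulrAC ltr_pdivrMr// => /ltW h1.
  move: h2; rewrite ltr_pdivrMr// => /ltW h2.
  have H1 := hl (x (l * t)) (x t); have H2 := hu (x (l * t)) (x t).
  have {}H1 : d ^+ 2 * (l `^ gamma) `^ beta * f (x t) <= f (x (l * t)).
    apply: H1; [lra|lra|]; apply: (le_trans h1).
    by rewrite mulrC ler_pM2r.
  have {}H2 : d ^+ 2 * f (x (l * t)) <= (l `^ gamma) `^ beta * f (x t).
    apply: H2; [lra|lra|]; apply: (le_trans h2).
    by rewrite !ler_pM2r.
  have G1 : d * (l `^ gamma) `^ sigma * g (x t) <= g (x (l * t)).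
    have {}h1 := ler_wpM2l (ltW d0) h1; rewrite -mulrA; apply: (le_trans h1).
    rewrite [leLHS](_ : _ = r * d * g (x (l * t))); last by ring.
    by rewrite ler_piMl// ltW.
  have G2 : d * g (x (l * t)) <= (l `^ gamma) `^ sigma * g (x t).
    have {}h2 := ler_wpM2l (ltW d0) h2; apply: (le_trans h2).
    rewrite [leLHS](_ : _ = r * d * ((l `^ gamma) `^ sigma * g (x t))); last by ring.
    by rewrite ler_piMl ?(ltW rd)// mulr_ge0// ltW.
  have d20 : 0 <= d ^+ 2 by rewrite exprn_ge0// ltW.
  split.
    rewrite ler_pdivlMr// (xE _ xl0) [in leLHS](xE _ xt0) {1}eb.
    rewrite [leLHS](_ : _ = d * (l `^ gamma) `^ sigma * g (x t) *
      (d ^+ 2 * (l `^ gamma) `^ beta * f (x t))); last by ring.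
    apply: ler_pM => //.
      exact: mulr_ge0 (mulr_ge0 (ltW d0) (ltW es0)) (ltW gt0').
    exact: mulr_ge0 (mulr_ge0 d20 (powR_ge0 _ _)) (ltW ft0).
  rewrite mulrA ler_pdivrMr// [in leLHS](xE _ xl0) [in leRHS](xE _ xt0) {1}eb.
  rewrite [leLHS](_ : _ = d * g (x (l * t)) * (d ^+ 2 * f (x (l * t)))); last by ring.
  rewrite [leRHS](_ : _ = (l `^ gamma) `^ sigma * g (x t) *
    ((l `^ gamma) `^ beta * f (x t))); last by ring.
  apply: ler_pM => //; first exact: mulr_ge0 (ltW d0) (ltW gl0).
  exact: mulr_ge0 d20 (ltW fl0).
apply: (@cvg_factor_squeeze _ _ _ 3) => // d /base; apply: filterS => t [].
  by [].
by [].
Unshelve. all: by end_near. Qed.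

End volterra.

(** * Karamata's theorem *)

(** The uniformity behind Karamata's theorem: over such a window the integral of [h] is nearly its
    length times [h x]. *)
Definition slowly_oscillating (R : realType) (h : R -> R) : Prop :=
  forall d : R, 0 < d < 1 -> exists2 r0 : R, 0 < r0 < 1 &
    \forall x \near +oo, forall u, r0 * x <= u <= x ->
      d * h x <= h u /\ d * h u <= h x.

Lemma quasi_increasing_slowly_oscillating (R : realType) (h : R -> R) (s : R) :
  0 <= s -> (\forall x \near +oo, 0 < h x) -> has_index s h ->
  quasi_increasing h -> slowly_oscillating h.
Proof.
move=> s0 hpos hs hq d d01; have [d0 d1] := andP d01.
have d1' : 1 < d^-1 by rewrite invf_gt1.
have [k [k1 kd dk]] := small_factor d01 d1'.
have k0 : 0 < k by apply: lt_trans k1.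
have s10 : 0 < s + 1 by rewrite ltr_wpDl.
(* The exponent $1/(s + 1)$, in place of $1/s$, covers $s = 0$ as well: $r_0^s = k^{-s/(s+1)} \ge
   k^{-1}$. *)
pose r0 := k^-1 `^ (s + 1)^-1.
have kV : 0 < k^-1 < 1 by rewrite invr_gt0 k0 invf_lt1.
have r00 : 0 < r0 by rewrite powR_gt0// invr_gt0.
have r01 : r0 < 1.
  have := @gt0_ltr_powR R (s + 1)^-1 _ k^-1 1; rewrite powR1; apply.
  - by rewrite invr_gt0.
  - by rewrite nnegrE ltW// invr_gt0.
  - by rewrite nnegrE.
  - by case/andP: kV.
have r0s : k^-1 <= r0 `^ s.
  rewrite /r0 -powRrM -{1}(powRr1 (ltW (andP kV).1)).
  apply: ger_powR; first by rewrite (andP kV).1 ltW ?(andP kV).2.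
  by rewrite mulrC ler_pdivrMr// mul1r lerDl.
pose k' := Num.sqrt k.
have k'1 : 1 < k' by rewrite -(sqrtr1 R) ltr_sqrt.
have k'0 : 0 < k' by apply: lt_trans k'1.
have kk : k = k' * k' by rewrite -expr2 sqr_sqrtr// ltW.
have [X X0 qX] := hq _ k'1.
have low : r0 `^ s / k' < r0 `^ s by rewrite ltr_pdivrMr// ltr_pMr// powR_gt0.
have hr := has_index_gt hpos hs r00 low.
exists r0; first by rewrite r00.
near=> x.
have Xx : X / r0 <= x by near: x; exact: near_pinfty_ge.
have Xx' : X <= x by near: x; exact: near_pinfty_ge.
have hrx : r0 `^ s / k' * h x < h (r0 * x) by near: x.
have hx : 0 < h x by near: x.
move=> u /andP[ru ux].
have Xr : X <= r0 * x by rewrite mulrC -ler_pdivrMr.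
have h1 := qX _ _ Xr ru.
have h2 := qX _ _ (le_trans Xr ru) ux.
have {h1}h3 : r0 `^ s / k' * h x <= k' * h u by apply: (le_trans (ltW hrx)).
have hu : 0 < h u.
  have : 0 < k' * h u by apply: lt_le_trans h3; rewrite mulr_gt0// divr_gt0// powR_gt0.
  by rewrite pmulr_rgt0.
split; last first.
  apply: (le_trans (ler_wpM2l (ltW d0) h2)); rewrite mulrA ler_piMl ?(ltW hx)//.
  apply: ltW; apply: le_lt_trans dk; rewrite mulrC ler_pM2r// kk ler_peMl// ltW//.
have : r0 `^ s * h x <= k * h u.
  by move: h3; rewrite mulrAC ler_pdivrMr// kk [in X in _ -> X]mulrAC.
move=> /(le_trans (ler_wpM2r (ltW hx) r0s)); rewrite ler_pdivrMl// => h4.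
have : d * h x <= d * (k ^+ 2 * h u).
  by rewrite ler_pM2l// expr2 -mulrA.
move=> /le_trans; apply; rewrite mulrA ler_piMl ?(ltW hu)//.
by rewrite mulrC -ler_pdivlMr// mul1r.
Unshelve. all: by end_near. Qed.

Lemma slowly_oscillating_inv (R : realType) (h : R -> R) :
  (forall u, 0 < u -> 0 < h u) -> slowly_oscillating h ->
  slowly_oscillating (fun u => (h u)^-1).
Proof.
move=> h0 ho d d01; have [r0 /[dup] /andP[r00 r01] r001 hr] := ho d d01.
exists r0 => //; near=> x.
have x0 : 0 < x by near: x; exact: near_pinfty_gt.
have hx : forall u, r0 * x <= u <= x -> d * h x <= h u /\ d * h u <= h x by near: x.
move=> u ux.
have u0 : 0 < u by case/andP: ux => ru _; apply: lt_le_trans ru; exact: mulr_gt0.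
have [h1 h2] := hx u ux.
have := h0 _ x0; have := h0 _ u0 => hu0 hx0.
by split; rewrite ler_pdivrMr// mulrC ler_pdivlMr.
Unshelve. all: by end_near. Qed.

Section karamata.
Context {R : realType}.
Implicit Types d r w : R.

(* Both bounds come from [1 + y <= expR y], applied to [y = w ln r], [- w ln r]
   and [- ln r]. *)
Lemma powR_chord d r0 w : 0 < d < 1 -> 0 < r0 < 1 -> 0 < w ->
  exists r, [/\ 0 < r, r0 <= r, r < 1, d * (1 - r `^ w) <= w * (1 - r) &
    d * (w * (1 - r)) <= 1 - r `^ w].
Proof.
move=> /andP[d0 d1] /andP[r00 r01] w0.
pose r := Num.max r0 (Num.max d (1 - (1 - d) / w)).
have r0r : r0 <= r by rewrite le_max lexx.
have dr : d <= r by rewrite !le_max lexx orbT.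
have wr : 1 - (1 - d) / w <= r by rewrite !le_max lexx !orbT.
have r0' : 0 < r by apply: lt_le_trans r0r.
have r1 : r < 1.
  by rewrite !gt_max r01 d1/= gtrBl divr_gt0// subr_gt0.
have wr' : w * (1 - r) <= 1 - d.
  by rewrite mulrC -ler_pdivlMr//; lra.
have rwE : r `^ w = expR (w * ln r) by rewrite /powR gt_eqF.
have lnr : 1 - r <= - ln r.
  have := expR_ge1Dx (ln r); rewrite lnK ?posrE//; lra.
have lnr' : - ln r <= (1 - r) / r.
  have := expR_ge1Dx (- ln r); rewrite expRN lnK ?posrE// mulrBl divff ?gt_eqF//; lra.
have rw0 : 0 < r `^ w by exact: powR_gt0.
exists r; split => //.
  have h1 : 1 - r `^ w <= w * (- ln r).
    have := expR_ge1Dx (w * ln r); rewrite -rwE; lra.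
  have {}h1 : 1 - r `^ w <= w * (1 - r) / r.
    by apply: (le_trans h1); rewrite -mulrA ler_pM2l.
  move: h1; rewrite ler_pdivlMr// => h1; apply: le_trans h1.
  rewrite mulrC ler_wpM2l// subr_ge0.
  have := @ge0_ler_powR R w (ltW w0) r 1; rewrite powR1; apply; rewrite ?nnegrE ?ltW//.
have h1 : 1 + w * (1 - r) <= (r `^ w)^-1.
  have := expR_ge1Dx (- (w * ln r)); rewrite expRN -rwE; apply: le_trans.
  by rewrite lerD2l -mulrN ler_pM2l.
have z0 : 0 < w * (1 - r) by rewrite mulr_gt0// subr_gt0.
have h2 : r `^ w * (1 + w * (1 - r)) <= 1.
  by rewrite mulrC -ler_pdivlMr// mul1r.
set z := w * (1 - r) in wr' z0 h2 *; set y := r `^ w in rw0 h2 *.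
have : d * z * (1 + z) <= z.
  by rewrite -mulrA mulrCA ler_piMr ?(ltW z0)//; nra.
have h3 : 0 < 1 + z by rewrite addr_gt0.
move=> h4; rewrite -(ler_pM2r h3); nra.
Qed.

Variables (P h : R -> R) (s X0 : R).
Hypothesis s1 : -1 < s.
Hypothesis X00 : 0 < X0.
Hypothesis hpos : \forall x \near +oo, 0 < h x.
Hypothesis hindex : has_index s h.
Hypothesis hosc : slowly_oscillating h.
Hypothesis hloc : forall T0 T, X0 <= T0 -> T0 <= T ->
  (forall u, T0 <= u -> 0 < h u) ->
  exists m C : R, 0 < m /\ forall u, T0 <= u <= T -> m <= h u <= C.
Hypothesis Ppos : \forall x \near +oo, 0 < P x.
(** [P] stands for a primitive of [h], known only through bounds on its increments; one argument
    then serves both [F] and [Mbar]. *)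
Hypothesis Pint : forall a b l u, X0 <= a -> a <= b ->
  (forall v, a <= v <= b -> l <= h v <= u) ->
  (b - a) * l <= P b - P a <= (b - a) * u.

Let w := 1 + s.
Let G x := P x / (x * h x).

Let w0 : 0 < w.
Proof. by rewrite /w -ltrBlDl sub0r. Qed.

Let start : exists T0, [/\ X0 <= T0, forall x, T0 <= x -> 0 < h x,
   forall x, T0 <= x -> 0 < P x & forall T, exists m C : R,
   [/\ 0 < m, 0 < C & forall x, T0 <= x <= T -> m <= G x <= C] ].
Proof.
have [T1 T10 hT1] := (near_pinftyP _).1 (filterI hpos Ppos).
pose T0 := Num.max X0 T1; exists T0.
have XT : X0 <= T0 by rewrite le_max lexx.
have T00 : 0 < T0 by apply: lt_le_trans XT.
have hP x : T0 <= x -> 0 < h x by rewrite ge_max => /andP[_ /hT1[]].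
have PP x : T0 <= x -> 0 < P x by rewrite ge_max => /andP[_ /hT1[]].
split => // T; have [TT|TT] := ltP T T0.
  exists 1, 1; split => // x /andP[/le_trans/[apply]].
  by rewrite leNgt TT.
have [m [C [m0 hmC]]] := hloc XT TT hP.
have C0 : 0 < C.
  by have /andP[] := hmC T0 (introT andP (conj (lexx _) TT)) => /(lt_le_trans m0)/lt_le_trans; apply.
have T0' : 0 < T by apply: lt_le_trans TT.
have Pnd a b : T0 <= a -> a <= b -> b <= T -> P a <= P b.
  move=> Ta ab bT.
  have /(Pint (le_trans XT Ta) ab) /andP[+ _] : forall v, a <= v <= b -> m <= h v <= C.
    by move=> v /andP[av vb]; apply: hmC; rewrite (le_trans Ta)//= (le_trans vb).
  by rewrite -[P a <= _]subr_ge0; apply: le_trans; rewrite mulr_ge0 ?(ltW m0)// subr_ge0.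
exists (P T0 / (T * C)), (P T / (T0 * m)); split.
- by rewrite divr_gt0 ?PP// mulr_gt0.
- by rewrite divr_gt0 ?PP// mulr_gt0.
move=> x /[dup] /hmC /andP[mh hC] /andP[Tx xT].
have x0 : 0 < x by apply: lt_le_trans Tx.
have hx := hP _ Tx.
have xh : 0 < x * h x by rewrite mulr_gt0.
apply/andP; split; apply: ler_pM.
- by rewrite ltW// PP.
- by rewrite invr_ge0 mulr_ge0// ltW.
- exact: Pnd.
- by rewrite lef_pV2 ?posrE ?mulr_gt0// ler_pM// ltW.
- by rewrite ltW// PP.
- by rewrite invr_ge0 ltW.
- exact: Pnd.
- by rewrite lef_pV2 ?posrE ?mulr_gt0// ler_pM// ltW.
Qed.

(** Splitting [P x] at [r * x] shows that [G] nearly satisfies $G(x) = r^w G(rx) + (1 - r)$. The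
    fixed point $(1 - r)/(1 - r^w)$ of this recursion is close to $1/w$ for [r] close to $1$. *)
Let step d r K : 0 < d < 1 -> 0 < r < 1 -> 1 < K ->
  (\forall x \near +oo, forall u, r * x <= u <= x ->
      d * h x <= h u /\ d * h u <= h x) ->
  \forall x \near +oo, r `^ w / K * G (r * x) + (1 - r) * d <= G x /\
    d * G x <= d * (r `^ w * K * G (r * x)) + (1 - r).
Proof.
move=> /andP[d0 d1] /andP[r0 r1] K1 osc.
have [T0 [XT hP PP _]] := start.
have K0 : 0 < K by apply: lt_trans K1.
have lo : r `^ s / K < r `^ s by rewrite ltr_pdivrMr// ltr_pMr// powR_gt0.
have hi : r `^ s < K * r `^ s by rewrite ltr_pMl// powR_gt0.
have n1 := has_index_gt hpos hindex r0 lo.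
have n2 := has_index_lt hpos hindex r0 hi.
near=> x.
have Tx : T0 <= x by near: x; exact: near_pinfty_ge.
have Trx : T0 / r <= x by near: x; exact: near_pinfty_ge.
have ox : forall u, r * x <= u <= x -> d * h x <= h u /\ d * h u <= h x.
  by near: x.
have h1 : r `^ s / K * h x < h (r * x) by near: x.
have h2 : h (r * x) < K * r `^ s * h x by near: x.
have Trx' : T0 <= r * x by rewrite mulrC -ler_pdivrMr.
have x0 : 0 < x by apply: lt_le_trans Tx; exact: lt_le_trans XT.
have hx := hP _ Tx; have hrx := hP _ Trx'; have Prx := PP _ Trx'.
have rx : r * x <= x by rewrite ler_piMl// ltW.
have xh : 0 < x * h x by rewrite mulr_gt0.
have rwE : r `^ w = r * r `^ s by rewrite /w powRD ?(gt_eqF r0) ?implybT// powRr1// ltW.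
have GrE : G (r * x) * (r * x * h (r * x)) = P (r * x).
  by rewrite /G divfK// gt_eqF// !mulr_gt0.
have GE : G x * (x * h x) = P x by rewrite /G divfK// gt_eqF.
have Gr0 : 0 < G (r * x) by rewrite divr_gt0// !mulr_gt0.
have /(Pint (le_trans XT Trx') rx) : forall v, r * x <= v <= x ->
    d * h x <= h v <= h x / d.
  by move=> v /ox[-> ov]; rewrite ler_pdivlMr// mulrC.
move=> /andP[Pl Pu]; split.
  rewrite -(ler_pM2r xh) GE mulrDl.
  have : r `^ w / K * G (r * x) * (x * h x) <= P (r * x).
    rewrite -GrE rwE.
    rewrite [leLHS](_ : _ = G (r * x) * (r * x * (r `^ s / K * h x))); last by ring.
    by rewrite ler_pM2l// ler_pM2l ?mulr_gt0// ltW.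
  move: Pl; rewrite (_ : (x - r * x) * (d * h x) = (1 - r) * d * (x * h x)); last by ring.
  lra.
rewrite -(ler_pM2r xh) [leLHS](_ : _ = d * P x); last by rewrite -mulrA GE.
rewrite mulrDl.
have : P (r * x) <= r `^ w * K * G (r * x) * (x * h x).
  rewrite -GrE rwE.
  rewrite [leRHS](_ : _ = G (r * x) * (r * x * (K * r `^ s * h x))); last by ring.
  by rewrite ler_pM2l// ler_pM2l ?mulr_gt0// ltW.
move=> /(ler_wpM2l (ltW d0)).
move: Pu; rewrite (_ : (x - r * x) * (h x / d) = (1 - r) * (x * h x) / d); last by ring.
rewrite ler_pdivlMr//.
rewrite -[_ * (r `^ w * K * G (r * x)) * _]mulrA; lra.
Unshelve. all: by end_near. Qed.

(** First [r] is taken so close to $1$ that the fixed point is within a factor [d] of $1/w$, then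
    [k] so close to $1$ that its error is small against the contraction gap $1 - r^w$. *)
Let setup d : 0 < d < 1 -> exists r k : R,
  [/\ 0 < r < 1, 1 < k, k * d < 1, 0 < r `^ w < 1 &
   [/\ k ^+ 2 <= 1 + (1 - d) * (1 - r `^ w),
    d * (1 - r `^ w) <= w * (1 - r), d * (w * (1 - r)) <= 1 - r `^ w &
    \forall x \near +oo, r `^ w / k * G (r * x) + (1 - r) * d <= G x /\
      d * G x <= d * (r `^ w * k * G (r * x)) + (1 - r)]].
Proof.
move=> d01; have [d0 d1] := andP d01; have [r0 r001 osc0] := hosc d01.
have [r [rp r0r r1 c1 c2]] := powR_chord d01 r001 w0.
have r01 : 0 < r < 1 by rewrite rp.
have osc : \forall x \near +oo, forall u, r * x <= u <= x ->
    d * h x <= h u /\ d * h u <= h x.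
  near=> x; have x0 : 0 < x by near: x; exact: near_pinfty_gt.
  have ox : forall u, r0 * x <= u <= x -> d * h x <= h u /\ d * h u <= h x by near: x.
  move=> u /andP[ru ux]; apply: ox; rewrite ux andbT; apply: le_trans ru.
  by rewrite ler_pM2r.
have rw1 : r `^ w < 1.
  rewrite -subr_gt0; apply: lt_le_trans c2.
  by rewrite !mulr_gt0// subr_gt0.
have K1 : 1 < 1 + (1 - d) * (1 - r `^ w) by rewrite ltrDl mulr_gt0// subr_gt0.
have [k [k1 kK kd]] := small_factor d01 K1.
exists r, k; split => //; first by rewrite powR_gt0.
by split => //; exact: step.
Unshelve. all: by end_near. Qed.

(** Here [y] is $r^w$, [a] is [G x] and [b] is [G (r * x)]. Almost minimality lets [a] replace [b]
    in the recursion, whence $a \ge d^3/w$, against $a \le k d^4/w$ and $k d < 1$. *)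
Let lower_contradiction d r k y a b : 0 < d < 1 -> 0 < r < 1 -> 1 < k -> k * d < 1 ->
  0 < y < 1 -> k ^+ 2 <= 1 + (1 - d) * (1 - y) -> d * (1 - y) <= w * (1 - r) ->
  0 < a -> y / k * b + (1 - r) * d <= a -> a <= k * b -> a <= k * (d ^+ 4 / w) ->
  False.
Proof.
move=> /andP[d0 d1] /andP[r0 r1] k1 kd /andP[y0 y1] kK c1 a0 st ab av.
have k0 : 0 < k by apply: lt_trans k1.
have r1' : 0 < 1 - r by rewrite subr_gt0.
have h1 : (1 - r) * d * k ^+ 2 <= a * (k ^+ 2 - y).
  have := ler_wpM2r (ltW (exprn_gt0 2 k0)) st.
  rewrite [leLHS](_ : _ = y * (k * b) + (1 - r) * d * k ^+ 2); last first.
    by field; rewrite gt_eqF.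
  have := ler_wpM2l (ltW y0) ab; lra.
have h2 : a * (k ^+ 2 - y) <= a * ((1 - y) * (2 - d)).
  by rewrite ler_pM2l//; lra.
have h3 : (1 - r) * d <= a * ((1 - y) * (2 - d)).
  apply: le_trans h2; apply: le_trans h1.
  by rewrite ler_peMr ?mulr_ge0 ?(ltW r1') ?(ltW d0)// exprn_ege1// ltW.
have h4 : (1 - r) * d ^+ 2 <= a * (1 - y).
  have := ler_wpM2l (ltW d0) h3.
  rewrite [leLHS](_ : _ = (1 - r) * d ^+ 2); last by ring.
  rewrite [leRHS](_ : _ = a * (1 - y) * (d * (2 - d))); last by ring.
  move=> /le_trans; apply; rewrite ler_piMr ?mulr_ge0 ?(ltW a0) ?subr_ge0 ?(ltW y1)//.
  have := sqr_ge0 (1 - d); lra.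
have h5 : d ^+ 3 <= a * w.
  rewrite -(ler_pM2l r1').
  have := ler_wpM2r (ltW d0) h4.
  rewrite [leLHS](_ : _ = (1 - r) * d ^+ 3); last by ring.
  move=> /le_trans; apply.
  rewrite [leLHS](_ : _ = a * (d * (1 - y))); last by ring.
  rewrite [leRHS](_ : _ = a * (w * (1 - r))); last by ring.
  by rewrite ler_pM2l.
have := ler_wpM2r (ltW w0) av.
rewrite [leRHS](_ : _ = k * d * d ^+ 3); last by field; rewrite gt_eqF.
move=> /(le_trans h5); apply/negP; rewrite -ltNge.
by rewrite gtr_pMl// exprn_gt0.
Qed.

Let upper_contradiction d r k y a b : 0 < d < 1 -> 0 < r < 1 -> 1 < k -> k * d < 1 ->
  0 < y < 1 -> k ^+ 2 <= 1 + (1 - d) * (1 - y) -> d * (w * (1 - r)) <= 1 - y ->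
  0 < a -> d * a <= d * (y * k * b) + (1 - r) -> b <= k * a ->
  1 <= k * (d ^+ 4 * w) * a -> False.
Proof.
move=> /andP[d0 d1] /andP[r0 r1] k1 kd /andP[y0 y1] kK c2 a0 st ba av.
have k0 : 0 < k by apply: lt_trans k1.
have r1' : 0 < 1 - r by rewrite subr_gt0.
have y1' : 0 < 1 - y by rewrite subr_gt0.
have h1 : d * a * (1 - y * k ^+ 2) <= 1 - r.
  have : d * (y * k * b) <= d * (y * k * (k * a)).
    by rewrite ler_pM2l// ler_pM2l// mulr_gt0.
  lra.
have h2 : d * (1 - y) <= 1 - y * k ^+ 2.
  have := ler_wpM2l (ltW y0) kK.
  have : y * ((1 - d) * (1 - y)) <= (1 - d) * (1 - y).
    by rewrite ler_piMl ?(ltW y1)// mulr_ge0 ?subr_ge0 ?(ltW d1)// ltW.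
  lra.
have h3 : d * a * (d * (1 - y)) <= 1 - r.
  by apply: le_trans h1; rewrite ler_pM2l// mulr_gt0.
have h4 : d ^+ 3 * w * a <= 1.
  rewrite -(ler_pM2l r1') mulr1; apply: le_trans h3.
  rewrite [leLHS](_ : _ = d ^+ 2 * a * (d * (w * (1 - r)))); last by ring.
  rewrite [leRHS](_ : _ = d ^+ 2 * a * (1 - y)); last by ring.
  by rewrite ler_pM2l// mulr_gt0// exprn_gt0.
have dwa : 0 < d ^+ 3 * w * a by rewrite !mulr_gt0// exprn_gt0.
have := le_trans h4 av.
rewrite [leRHS](_ : _ = k * d * (d ^+ 3 * w * a)); last by ring.
by apply/negP; rewrite -ltNge gtr_pMl.
Qed.

(** The method used for [q]: the recursion is read at almost minima of [G] for the lower bound and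
    of $1/G$ for the upper one. *)
Lemma karamata : G x @[x --> +oo] --> w^-1.
Proof.
have [T0 [XT hP PP loc]] := start.
have T00 : 0 < T0 by exact: lt_le_trans XT.
have Gpos x : T0 <= x -> 0 < G x.
  move=> Tx; apply: divr_gt0; first exact: PP.
  by rewrite mulr_gt0 ?hP// (lt_le_trans T00).
apply: (@cvg_factor_squeeze _ _ _ 4) => [|d d01|d d01]; first by rewrite invr_gt0.
  have [d0 d1] := andP d01.
  have [r [k [r01 k1 kd /andP[y0 y1] [kK c1 c2 st]]]] := setup d01.
  have [r0 r1] := andP r01; have k0 : 0 < k by apply: lt_trans k1.
  apply: contrapT => /not_near_pinfty nG.
  have {}nG T : exists2 t, T <= t & G t < d ^+ 4 / w.
    by have [t tT /negP] := nG T; rewrite -ltNge; exists t.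
  have glb T : exists2 m : R, 0 < m & forall x, T0 <= x <= T -> m <= G x.
    have [m [C [m0 _ mG]]] := loc T.
    by exists m => // x /mG /andP[].
  have v0 : 0 < d ^+ 4 / w by rewrite divr_gt0// exprn_gt0.
  have [S T0S GS] := almost_running_min glb k1 v0 nG.
  have S0 : 0 < S by apply: lt_le_trans T0S.
  have [T1 T10 hT1] := (near_pinftyP _).1 st.
  (* Beyond [S / r] the point [r * t] still lies after [S], where almost minimality applies. *)
  have [t [Tt St Gt Gs]] := GS (Num.max T1 (S / r)).
  have /andP[T1t Srt] : (T1 <= t) && (S / r <= t) by rewrite -ge_max.
  have [h1 _] := hT1 _ T1t.
  have t0 : 0 < t by apply: lt_le_trans St.
  have Srt' : S <= r * t by rewrite mulrC -ler_pdivrMr.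
  have h2 : G t <= k * G (r * t).
    by apply: Gs; rewrite Srt'/= ler_piMl// ltW.
  have G0 := Gpos t (le_trans T0S St).
  by apply: (lower_contradiction d01 r01 k1 kd _ kK c1 G0 h1 h2 Gt); rewrite y0.
have [d0 d1] := andP d01.
have [r [k [r01 k1 kd /andP[y0 y1] [kK c1 c2 st]]]] := setup d01.
have [r0 r1] := andP r01; have k0 : 0 < k by apply: lt_trans k1.
apply: contrapT => /not_near_pinfty nG.
pose p x := (G x)^-1.
have {}nG T : exists2 t, T <= t & p t < d ^+ 4 * w.
  have [t tT /negP] := nG (Num.max T T0).
  move: tT; rewrite ge_max => /andP[Tt T0t]; rewrite -ltNge => h1; exists t => //.
  have G0 := Gpos t T0t.
  by move: h1; rewrite -[_^-1]div1r ltr_pdivrMr// mulrAC /p -[_^-1]div1r ltr_pdivrMr.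
have plb T : exists2 m : R, 0 < m & forall x, T0 <= x <= T -> m <= p x.
  have [m [C [m0 C0 mG]]] := loc T.
  exists C^-1; first by rewrite invr_gt0.
  move=> x /mG /andP[mx xC].
  by rewrite /p lef_pV2 ?posrE// (lt_le_trans m0).
have v0 : 0 < d ^+ 4 * w by rewrite mulr_gt0// exprn_gt0.
have [S T0S pS] := almost_running_min plb k1 v0 nG.
have S0 : 0 < S by apply: lt_le_trans T0S.
have [T1 T10 hT1] := (near_pinftyP _).1 st.
have [t [Tt St pt ps]] := pS (Num.max T1 (S / r)).
have /andP[T1t Srt] : (T1 <= t) && (S / r <= t) by rewrite -ge_max.
have [_ h1] := hT1 _ T1t.
have t0 : 0 < t by apply: lt_le_trans St.
have Srt' : S <= r * t by rewrite mulrC -ler_pdivrMr.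
have G0 := Gpos t (le_trans T0S St).
have G0' := Gpos (r * t) (le_trans T0S Srt').
have h2 : G (r * t) <= k * G t.
  have : p t <= k * p (r * t) by apply: ps; rewrite Srt'/= ler_piMl// ltW.
  by rewrite /p ler_pdivlMr// mulrC ler_pdivrMr.
apply: (upper_contradiction d01 r01 k1 kd _ kK c2 G0 h1 h2); first by rewrite y0.
by move: pt; rewrite /p -[_^-1]div1r ler_pdivrMr.
Qed.

End karamata.

(** * The solution of the integral equation *)

Section solution.
Context {R : realType}.
Local Notation mu := (@lebesgue_measure R).
Variables (M f x : R -> R) (xi : R).
Hypothesis M0 : forall t, 0 <= M t.
Hypothesis Mnd : {homo M : s t / s <= t}.
Hypothesis fc : pos_continuous f.
Hypothesis xi0 : 0 < xi.
Hypothesis xsol : is_solution M f xi x.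

Let x0 t : 0 <= t -> 0 < x t.
Proof. by case: xsol => _ + _; apply. Qed.

Let f_x_continuous t : {within `[0, t], continuous (f \o x)}.
Proof.
have [cx _ _] := xsol.
have {}cx : {within `[0, t], continuous x}.
  by apply: continuous_subspaceW cx; exact: subset_itvl.
move=> s; apply/subspace_continuousP: s => s s0t.
apply: (@cvg_comp _ _ _ x f _ (nbhs (x s))).
  by move/subspace_continuousP : cx; exact.
have [cf _] := fc; apply: cf; rewrite in_itv/= andbT x0//.
by move: s0t; rewrite /= in_itv/= => /andP[].
Qed.

Let h t s := M (t - s) * f (x s).

Let h_ge0 t s : 0 <= s -> 0 <= h t s.
Proof. by move=> s0; rewrite mulr_ge0// ltW// fc.2// x0. Qed.

(** As [M] may jump, integrability rests on the measurability of monotone functions and on a bound,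
    not on continuity. *)
Let h_integrable t T : mu.-integrable `[0, T] (EFin \o h t).
Proof.
have [T0|T0] := ltP T 0.
  by rewrite set_itv_ge ?bnd_simp -?ltNge//; exact: integrable_set0.
have [c _ cm] := EVT_max T0 (@f_x_continuous T).
apply: (@bounded_integrable_itv _ _ _ _ (M t * f (x c))).
  apply: measurable_funM.
    apply: measurableT_comp; last exact: measurable_funB.
    exact: nondecreasing_measurable.
  exact: subspace_continuous_measurable_fun.
move=> s /[dup] s0T /andP[s0 sT]; rewrite ger0_norm ?h_ge0// ler_pM//.
- by rewrite ltW// fc.2// x0.
- by apply: Mnd; rewrite gerBl.
- by apply: cm; rewrite in_itv.
Qed.

Let xE t : 0 <= t -> x t = xi + \int[mu]_(s in `[0, t]) h t s.
Proof. by case: xsol => _ _; apply. Qed.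

Lemma solution_ge t : 0 <= t -> xi <= x t.
Proof.
move=> t0; rewrite xE// lerDl; apply: Rintegral_ge0 => s /=.
by rewrite in_itv/= => /andP[s0 _]; exact: h_ge0.
Qed.

(** The increment is the integral of $(M(t - u) - M(s - u)) f(x(u))$ over $[0, s]$ plus a
    nonnegative integral over $[s, t]$. *)
Lemma solution_nondecreasing s t : 0 <= s -> s <= t -> x s <= x t.
Proof.
move=> s0 st; have t0 := le_trans s0 st.
rewrite (xE s0) (xE t0) lerD2l (Rintegral_itv_split s0 st)//.
rewrite ler_wpDr//.
  apply: Rintegral_ge0 => u /=; rewrite in_itv/= => /andP[su _].
  by apply: h_ge0; apply: le_trans su.
apply: le_Rintegral => // u /=; rewrite in_itv/= => /andP[u0 _].
apply: ler_wpM2r; first exact/ltW/fc.2/x0.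
by apply: Mnd; rewrite lerB.
Qed.

Lemma solution_lower_sum (t : R) (n : nat) (l : nat -> R) : 0 < t -> (0 < n)%N ->
  (forall i s, (i < n)%N -> i%:R / n%:R * t <= s <= i.+1%:R / n%:R * t ->
     l i <= M (t - s) * f (x s)) ->
  t / n%:R * \sum_(i < n) l i <= x t.
Proof.
move=> t0 n0 hl; rewrite xE ?(ltW t0)// ler_wpDl ?(ltW xi0)//.
exact: Rintegral_lower_sum.
Qed.

Lemma solution_upper_sum (t : R) (n : nat) (u : nat -> R) : 0 < t -> (0 < n)%N ->
  (forall i s, (i < n)%N -> i%:R / n%:R * t <= s <= i.+1%:R / n%:R * t ->
     M (t - s) * f (x s) <= u i) ->
  x t <= xi + t / n%:R * \sum_(i < n) u i.
Proof.
move=> t0 n0 hu; rewrite xE ?(ltW t0)// lerD2l.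
exact: Rintegral_upper_sum.
Qed.

(** On $[\xi, \infty)$ [f] has a positive lower bound [m], by compactness and divergence. For $t \ge
    2 T_0$ the first half of the integral then contributes at least $(t/2) M(T_0) m$. *)
Lemma solution_pinfty : (\forall t \near +oo, 0 < M t) ->
  f u @[u --> +oo] --> +oo -> x t @[t --> +oo] --> +oo.
Proof.
move=> Mpos foo.
have [T0 T00 MT0] := (near_pinftyP _).1 Mpos.
have [Y Y0 fY] := (near_pinftyP _).1 (proj1 (cvgryPge _) foo 1).
have xiY : xi <= xi + Y by rewrite lerDl ltW.
have [c cI cm] := EVT_min xiY (pos_continuous_within (b := xi + Y) fc xi0).
pose m := Num.min 1 (f c).
have fc0 : 0 < f c.
  by apply: fc.2; move: cI; rewrite in_itv/= => /andP[+ _]; apply: lt_le_trans.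
have m0 : 0 < m by rewrite lt_min ltr01.
have fm u : xi <= u -> m <= f u.
  move=> xu; have [uY|Yu] := leP u (xi + Y).
    apply: (@le_trans _ _ (f c)); first by rewrite ge_min lexx orbT.
    by apply: cm; rewrite in_itv/= xu.
  apply: (@le_trans _ _ 1); first by rewrite ge_min lexx.
  by apply: fY; apply: le_trans (ltW Yu); rewrite lerDr ltW.
have MT := MT0 _ (lexx T0).
apply/cvgryPge => A; near=> t.
have t2 : 2 * T0 <= t by near: t; exact: near_pinfty_ge.
have tA : 2 * A / (M T0 * m) <= t by near: t; exact: near_pinfty_ge.
have t0 : 0 < t by apply: lt_le_trans t2; rewrite mulr_gt0.
pose l (i : nat) := if i == 0%N then M T0 * m else 0.
have : t / 2%:R * \sum_(i < 2) l i <= x t.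
  apply: solution_lower_sum => // i s i2 /andP[ls si].
  have s0 : 0 <= s by apply: le_trans ls; rewrite mulr_ge0 ?divr_ge0// ltW.
  rewrite /l; case: eqP si => [->|_] si; last exact: h_ge0.
  apply: ler_pM; [exact: M0|exact: ltW| |exact/fm/solution_ge].
  by apply: Mnd; lra.
apply: le_trans; rewrite !big_ord_recl big_ord0 /l/= !addr0.
by move: tA; rewrite ler_pdivrMr ?mulr_gt0//; lra.
Unshelve. all: by end_near. Qed.

End solution.

(** * Karamata's theorem for actual integrals *)

Section karamata_integral.
Context {R : realType}.
Local Notation mu := (@lebesgue_measure R).

Lemma karamata_integral (h : R -> R) (s c : R) : -1 < s -> 0 <= c <= 1 ->
  (forall T, mu.-integrable `[c, T] (EFin \o h)) -> (forall u, c <= u -> 0 <= h u) ->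
  (\forall t \near +oo, 0 < h t) -> has_index s h -> slowly_oscillating h ->
  (forall a b, 1 <= a -> a <= b -> (forall u, a <= u -> 0 < h u) ->
     exists m C : R, 0 < m /\ forall u, a <= u <= b -> m <= h u <= C) ->
  oriented_integral c t h / (t * h t) @[t --> +oo] --> (1 + s)^-1.
Proof.
move=> s1 /andP[c0 c1] hi h0 hpos hs ho hloc.
have split a b : 1 <= a -> a <= b ->
    oriented_integral c b h - oriented_integral c a h = \int[mu]_(u in `[a, b]) h u.
  move=> a1 ab; have ca : c <= a by apply: le_trans a1.
  rewrite /oriented_integral ca (le_trans ca ab) (Rintegral_itv_split ca ab)//.
  by rewrite addrC addKr.
have hab a b : 1 <= a -> mu.-integrable `[a, b] (EFin \o h).
  move=> a1; apply: integrableS (hi b) => //; apply: subset_itvr.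
  by rewrite bnd_simp (le_trans c1).
apply: (@karamata _ (fun t => oriented_integral c t h) h s 1) => //; last first.
  move=> a b l u a1 ab hlu; rewrite split//; apply/andP; split.
    by apply: Rintegral_itv_ge => //; [exact: hab|move=> v /hlu /andP[]].
  by apply: Rintegral_itv_le => //; [exact: hab|move=> v /hlu /andP[]].
have [T T0 hT] := (near_pinftyP _).1 hpos.
pose a := Num.max 1 T.
have a1 : 1 <= a by rewrite le_max lexx.
have ha u : a <= u -> 0 < h u by rewrite ge_max => /andP[_]; exact: hT.
have aa1 : a <= a + 1 by rewrite lerDl.
have [m [C [m0 hm]]] := hloc _ _ a1 aa1 ha.
near=> t; have ta : a + 1 <= t by near: t; exact: near_pinfty_ge.
have cat : c <= a by apply: le_trans a1.
have Pa : 0 <= oriented_integral c a h.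
  rewrite /oriented_integral cat; apply: Rintegral_ge0 => u /=.
  by rewrite in_itv/= => /andP[cu _]; exact: h0.
(* Near [c] only nonnegativity of [h] is known, so positivity of the integral is drawn from
   $[a, a + 1]$. *)
have P1 : 0 < oriented_integral c (a + 1) h.
  apply: (lt_le_trans m0); rewrite -[leRHS](subrK (oriented_integral c a h)) split//.
  rewrite ler_wpDr//; have := @Rintegral_itv_ge _ h a (a + 1) m aa1 (hab _ _ a1).
  have -> : a + 1 - a = 1 by ring.
  by rewrite mul1r; apply => u /hm /andP[].
apply: (lt_le_trans P1); rewrite -subr_ge0 split//; last by apply: le_trans a1 aa1.
apply: Rintegral_ge0 => u /=; rewrite in_itv/= => /andP[au _].
by apply/ltW/ha; apply: le_trans au.
Unshelve. all: by end_near. Qed.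

End karamata_integral.

(** Eventually [f] is within a factor $\sqrt k$ of the increasing [phi]; passing to [phi] and back
    costs [k]. *)
Lemma asymp_increasing_quasi_increasing (R : realType) (f : R -> R) :
  (forall u, 0 < u -> 0 < f u) -> asymp_increasing f -> quasi_increasing f.
Proof.
move=> f0 [phi [[cphi phi0] [dphi _] dphi0 fphi]] k k1.
have k0 : 0 < k by apply: lt_trans k1.
pose r := Num.sqrt k.
have r1 : 1 < r by rewrite -(sqrtr1 R) ltr_sqrt.
have r0 : 0 < r by apply: lt_trans r1.
have rr : k = r * r by rewrite -expr2 sqr_sqrtr// ltW.
have phind a b : 0 <= a -> a <= b -> phi a <= phi b.
  move=> a0 ab; apply: (@ger0_derive1_ndecry R phi 0) => //.
  - by move=> u; rewrite in_itv/= andbT; exact: dphi.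
  - by move=> u; rewrite in_itv/= andbT => /dphi0/ltW.
have n1 : \forall u \near +oo, f u / phi u < r by apply: (cvgr_lt _ fphi).
have n2 : \forall u \near +oo, r^-1 < f u / phi u.
  by apply: (cvgr_gt _ fphi); rewrite invf_lt1.
have [X X0 hX] := (near_pinftyP _).1 (filterI n1 n2).
exists X => // a b Xa ab.
have [h1 _] := hX a Xa; have [_ h2] := hX b (le_trans Xa ab).
have a0 : 0 < a by apply: lt_le_trans Xa.
have b0 : 0 < b by apply: lt_le_trans ab.
move: h1 h2; rewrite ltr_pdivrMr ?phi0 ?(ltW a0)// ltr_pdivlMr ?phi0 ?(ltW b0)//.
rewrite ltr_pdivrMl// => /ltW h1 /ltW h2.
apply: (le_trans h1); rewrite rr -mulrA ler_pM2l//; apply: le_trans h2.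
by apply: phind => //; exact: ltW.
Qed.

(** * The cumulative function of the measure *)

Section cumul_lemmas.
Context {R : realType}.
Variable mu : {measure set (measurableTypeR R) -> \bar R}.

Lemma cumul_ge0 (t : R) : 0 <= cumul mu t.
Proof. exact: fine_ge0. Qed.

(** Monotonicity extends to the whole line because the interval is empty, and its measure zero, at
    negative arguments. *)
Lemma cumul_nondecreasing :
  (forall t : R, 0 <= t -> (mu `[0%R, t]%classic < +oo)%E) ->
  {homo cumul mu : s t / s <= t}.
Proof.
move=> fin s t st; have [s0|s0] := ltP s 0.
  by rewrite {1}/cumul set_itv_ge ?measure0 ?cumul_ge0// bnd_simp -ltNge.
have t0 := le_trans s0 st.
apply: fine_le.
- by rewrite ge0_fin_numE// fin.
- by rewrite ge0_fin_numE// fin.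
- apply: le_measure; rewrite ?inE//=.
  by apply: subset_itvl; rewrite bnd_simp.
Qed.

End cumul_lemmas.

Theorem theorem4 (R : realType)
    (mu : {measure set (measurableTypeR R) -> \bar R})
    (theta beta xi : R) (f x : R -> R)
    (M_fin : forall t : R, 0 <= t -> (mu `[0%R, t]%classic < +oo)%E)
    (M_infty : cumul mu t @[t --> +oo] --> +oo)
    (theta_ge0 : 0 <= theta)
    (M_RV : regularly_varying theta (cumul mu))
    (f_ge0 : forall u : R, 0 <= u -> 0 <= f u)
    (f_cont : {in `]0, +oo[, continuous f})
    (f_gt0 : forall u : R, 0 < u -> 0 < f u)
    (beta_01 : 0 <= beta < 1)
    (f_RV : regularly_varying beta f)
    (f_beta0 : beta = 0 ->
      asymp_increasing f /\ f u @[u --> +oo] --> +oo)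
    (xi_gt0 : 0 < xi)
    (x_sol : is_solution (cumul mu) f xi x) :
  let F := fun y : R => oriented_integral 1 y (fun u => (f u)^-1) in
  let Mbar := fun t : R => oriented_integral 0 t (cumul mu) in
  regularly_varying ((1 + theta) / (1 - beta)) x /\
  F (x t) / Mbar t @[t --> +oo] -->
    Gamma (theta + 1) * Gamma ((1 + beta * theta) / (1 - beta)) /
    Gamma ((1 + theta) / (1 - beta)).
Proof.
move=> F Mbar.
have beta0 : 0 <= beta by case/andP: beta_01.
have beta1 : beta < 1 by case/andP: beta_01.
set M := cumul mu.
have M0 : forall t, 0 <= M t by exact: cumul_ge0.
have Mnd : {homo M : s t / s <= t} := cumul_nondecreasing M_fin.
have Mpos : \forall t \near +oo, 0 < M t by exact: (proj1 (cvgryPgt _) M_infty).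
have Mindex : has_index theta M by case: M_RV.
have fc : pos_continuous f by split.
have findex : has_index beta f by case: f_RV.
have [fq foo] : quasi_increasing f /\ f u @[u --> +oo] --> +oo.
  move: beta0; rewrite le_eqVlt => /predU1P[/esym b0|b0].
    have [fi foo] := f_beta0 b0.
    by split=> //; exact: asymp_increasing_quasi_increasing.
  split; last exact: has_index_pinfty findex b0.
  by move=> k; exact: has_index_quasi_monotone findex b0.
have xxi := solution_ge M0 fc x_sol.
have xnd := solution_nondecreasing M0 Mnd fc x_sol.
have xlow := solution_lower_sum M0 Mnd fc xi_gt0 x_sol.
have xupp := solution_upper_sum M0 Mnd fc x_sol.
have xoo : x t @[t --> +oo] --> +oo := solution_pinfty M0 Mnd fc xi_gt0 x_sol Mpos foo.
have ratio := ratio_cvg theta_ge0 beta_01 xi_gt0 M0 Mnd Mpos Mindex fc findex fq foo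
  xxi xnd xoo xlow xupp.
have xindex := x_has_index theta_ge0 beta_01 xi_gt0 M0 Mnd Mpos Mindex fc findex fq foo
  xxi xnd xoo xlow xupp.
have sigma0 : 0 < 1 - beta by rewrite subr_gt0.
have theta1 : 0 < 1 + theta by rewrite ltr_pwDl.
split.
  split => //; first by apply: subspace_continuous_measurable_fun => //; case: x_sol.
  near=> t; case: x_sol => _ + _; apply; near: t; exact: near_pinfty_ge.
set gamma := (1 + theta) / (1 - beta) in ratio *.
(* A form of $\gamma(1 - \beta) = 1 + \theta$ that matches the arguments of [Gamma_mul] and turns
   the claimed limit into $\gamma J$. *)
have gammaE : gamma = theta + gamma * beta + 1.
  by rewrite /gamma; field; rewrite gt_eqF.
have gb0 : 0 <= gamma * beta by rewrite mulr_ge0// divr_ge0// ltW.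
have -> : (1 + beta * theta) / (1 - beta) = gamma * beta + 1.
  by rewrite /gamma; field; rewrite gt_eqF.
rewrite {2}gammaE Gamma_mul// -gammaE.
have fo : slowly_oscillating f.
  exact: quasi_increasing_slowly_oscillating beta0 (near_gt0 fc.2) findex fq.
have Mq : quasi_increasing M.
  move=> k k1; exists 1 => // a b _ ab; apply: (le_trans (Mnd _ _ ab)).
  by rewrite ler_peMl// ltW.
have Mo := quasi_increasing_slowly_oscillating theta_ge0 Mpos Mindex Mq.
have MK : Mbar t / (t * M t) @[t --> +oo] --> (1 + theta)^-1.
  apply: karamata_integral => //.
  - by rewrite (lt_le_trans _ theta_ge0)// ltrN10.
  - by rewrite lexx ler01.
  - move=> T; apply: (@bounded_integrable_itv _ _ _ _ (M T)).
      exact: nondecreasing_measurable.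
    by move=> s /andP[_ sT]; rewrite ger0_norm// Mnd.
  - move=> a b a1 ab Ma; exists (M a), (M b); split; first exact: Ma.
    by move=> u /andP[au ub]; rewrite !Mnd.
pose fV (u : R) := (f u)^-1.
have fVc : pos_continuous fV.
  split=> [u|u u0]; last by rewrite invr_gt0 fc.2.
  rewrite in_itv/= andbT => u0; apply: cvgV; first by rewrite gt_eqF// fc.2.
  by apply: fc.1; rewrite in_itv/= andbT.
(* The integrand $1/f$ has index $-\beta > -1$, so the limit is $1/(1 - \beta)$. *)
have FK : F y / (y * fV y) @[y --> +oo] --> (1 - beta)^-1.
  apply: karamata_integral => //.
  - by rewrite ltrN2.
  - by rewrite lexx ler01.
  - move=> T; apply: continuous_compact_integrable; first exact: segment_compact.
    exact: pos_continuous_within.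
  - by move=> u u1; apply/ltW/fVc.2/(lt_le_trans ltr01).
  - exact: near_gt0 fVc.2.
  - move=> l l0; rewrite powRN.
    have : (f (l * y) / f y)^-1 @[y --> +oo] --> (l `^ beta)^-1.
      by apply: cvgV; [rewrite gt_eqF// powR_gt0|exact: findex].
    apply: cvg_trans; apply: near_eq_cvg; near=> y.
    by rewrite /fV invfM.
  - exact: slowly_oscillating_inv fc.2 fo.
  - move=> a b a1 ab _; have a0 : 0 < a by apply: lt_le_trans a1.
    have fVab := pos_continuous_within (b := b) fVc a0.
    have [c1 c1I c1m] := EVT_min ab fVab.
    have [c2 c2I c2m] := EVT_max ab fVab.
    exists (fV c1), (fV c2); split.
      apply: fVc.2; move: c1I; rewrite in_itv/= => /andP[+ _].
      exact: lt_le_trans.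
    by move=> u uab; rewrite c1m ?c2m// in_itv.
have FxK : F (x t) / (x t * fV (x t)) @[t --> +oo] --> (1 - beta)^-1.
  exact: (cvg_comp _ _ xoo FK).
set J := fine _ in ratio *.
(* [F (x t) / Mbar t] factors into the two Karamata ratios and [q], with limits $1/(1 - \beta)$, $1
   + \theta$ and [J]. *)
have : F (x t) / (x t * fV (x t)) * (x t / f (x t) / (t * M t)) *
    (Mbar t / (t * M t))^-1 @[t --> +oo] --> (1 - beta)^-1 * J * (1 + theta)^-1^-1.
  apply: cvgM; first exact: cvgM.
  by apply: cvgV => //; rewrite gt_eqF// invr_gt0.
have -> : (1 - beta)^-1 * J * (1 + theta)^-1^-1 = gamma * J.
  by rewrite invrK /gamma; ring.
apply: cvg_trans; apply: near_eq_cvg; near=> t.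
have t0 : 0 < t by near: t; exact: near_pinfty_gt.
have Mt : 0 < M t by near: t.
have xt : 0 < x t by apply: lt_le_trans (xxi _ (ltW t0)).
have fxt := fc.2 _ xt.
rewrite [(Mbar t / _)^-1]invf_div /fV.
by move: (F (x t)) (Mbar t)^-1 => A B; field; rewrite !gt_eqF.
Unshelve. all: by end_near. Qed.
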